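(* Let $\Pi$ be any one of the problems Feedback Vertex Set, Even Cycle Transversal, Odd Cycle Transversal. Then: (I) $\Pi$ parameterized by solution size $k$ is $(\mathrm{AL}, n\log n)$-hard, even when restricted to input graphs $G$ with average degree $\Delta_{av}(G)=O(1)$; (II) $\Pi$ parameterized by solution size $k$ is $(\mathrm{AL}, n/p, p)$-hard for every $p\in\mathbb{N}$, even when restricted to input graphs $G$ with maximum degree $\Delta(G)=O(1)$; (III) $\Pi$ parameterized by vertex cover size $K$ is $(\mathrm{VA}, n/p, p)$-hard for every $p\in\mathbb{N}$, even when restricted to input graphs $G$ with average degree $\Delta_{av}(G)=O(1)$.
   Context: All graphs are finite, simple and undirected; $n$ is the number of vertices of the input graph $G$, and the vertex set is known in advance. $\Delta(G)$ and $\Delta_{av}(G)$ denote the maximum and the average degree of $G$; ''restricted to graphs with $\Delta(G)=O(1)$'' (resp. $\Delta_{av}(G)=O(1)$) means that the hardness holds already for inputs in which this quantity is at most some absolute constant. In each problem the input is a graph $G$ (presented as a stream) and a non-negative integer $k$, and the question is whether there is a set $X\subset V(G)$ of size at most $k$ such that $G\setminus X$ (the subgraph induced by $V(G)\setminus X$) contains: no cycle (Feedback Vertex Set); no cycle of even length (Even Cycle Transversal); no cycle of odd length (Odd Cycle Transversal). When a problem is parameterized by vertex cover size $K$, the algorithm is additionally given an integer $K$ with the promise that the minimum vertex cover of $G$ has size at most $K$, and $k\le K$. AL (adjacency list) model: the vertices are exposed one after another in an arbitrary order; when a vertex $v$ is exposed, all edges incident to $v$ are revealed one by one in an arbitrary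 order (so each edge appears twice in the stream). VA (vertex arrival) model: the vertices are exposed one after another in an arbitrary order; when a vertex $v$ is exposed, all edges between $v$ and its already exposed neighbors are revealed one by one in an arbitrary order. A $p$-pass streaming algorithm may read the stream $p$ times in the same order. It solves a problem in a streaming model if it is a (possibly randomized) algorithm which, on every input instance presented in that model, gives the correct output with probability at least $2/3$. For a streaming model $\mathcal{M}$ and a function $f$ of $n$ and the parameter, a problem is $(\mathcal{M},f,p)$-hard if no $p$-pass streaming algorithm using $o(f)$ bits of space solves it in model $\mathcal{M}$; $(\mathcal{M},f)$-hard means $(\mathcal{M},f,1)$-hard. *)

(* Defs.v *)
From HB Require Import structures.
From mathcomp Require Import all_boot all_order all_algebra.
From mathcomp Require Import classical_sets filter reals topology normedtype landau exp.
Set Implicit Arguments.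
Unset Strict Implicit.
Unset Printing Implicit Defensive.
Import Order.TTheory GRing.Theory Num.Theory.
Import numFieldNormedType.Exports.

Record graph (n : nat) := Graph {
  adj :> rel 'I_n;
  adj_sym : symmetric adj;
  adj_irr : irreflexive adj }.

Section Graphs.
Variables (n : nat) (G : graph n).

Definition degree (v : 'I_n) : nat := #|[set u | G v u]|.

Definition max_degree : nat := \max_(v < n) degree v.

Definition avg_degree (R : realType) : R :=
  ((\sum_(v < n) degree v)%:R / n%:R)%R.

Definition vertex_cover (C : {set 'I_n}) : bool :=
  [forall u, forall v, G u v ==> (u \in C) || (v \in C)].

(* The default value n is the size of the full vertex set, which is a cover. *)
Definition vertex_cover_number : nat :=
  \big[minn/n]_(C : {set 'I_n} | vertex_cover C) #|C|.

End Graphs.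

(* [ucycleb] alone also accepts the empty sequence and single edges
   [:: u; v], hence the lower bound on the size.                        *)
Definition graph_cycle n (e : rel 'I_n) (c : seq 'I_n) : bool :=
  (2 < size c) && ucycleb e c.

(* G \ X, kept on the same vertex type: the vertices of X become isolated,
   which does not affect the cycles.                                      *)
Definition delete n (G : graph n) (X : {set 'I_n}) : rel 'I_n :=
  [rel u v in ~: X | G u v].

Inductive problem :=
  | FeedbackVertexSet
  | EvenCycleTransversal
  | OddCycleTransversal.

Definition forbidden_length (Pi : problem) (l : nat) : bool :=
  match Pi with
  | FeedbackVertexSet => true
  | EvenCycleTransversal => ~~ odd l
  | OddCycleTransversal => odd l
  end.

Definition yes_instance (Pi : problem) n (G : graph n) (k : nat) : Prop :=
  exists X : {set 'I_n}, #|X| <= k /\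
    ~ exists c, graph_cycle (delete G X) c /\ forbidden_length Pi (size c).

Inductive token (n : nat) :=
  | Expose of 'I_n
  | Edge of 'I_n & 'I_n.

Inductive model := AL | VA.

(* The neighbours of v whose edges to v are revealed when v is exposed,
   the vertices being exposed in the order vs.                            *)
Definition revealed (M : model) n (G : graph n) (vs : seq 'I_n) (v : 'I_n)
    : seq 'I_n :=
  match M with
  | AL => [seq u <- vs | G v u]
  | VA => [seq u <- take (index v vs) vs | G v u]
  end.

Definition stream_of (M : model) n (G : graph n) (sigma : seq (token n))
    : Prop :=
  exists (vs : seq 'I_n) (nb : 'I_n -> seq 'I_n),
    [/\ perm_eq vs (enum 'I_n),
        forall v, perm_eq (nb v) (revealed M G vs v) &
        sigma = flatten [seq Expose v :: [seq Edge v u | u <- nb v] | v <- vs]].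

(* A randomized streaming algorithm with s bits of memory.  Only the memory
   is charged: the random outcome w, the number of the current pass and the
   position in the stream may be consulted for free, which covers both coins
   tossed afresh at every step and a random string fixed in advance.
   Finitely many outcomes, with arbitrary real weights, are enough: on inputs
   of bounded length there are finitely many deterministic behaviours.      *)
Record algorithm (R : realType) (T : Type) (s : nat) := Algorithm {
  outcome : finType;
  weight : outcome -> R;
  weight_ge0 : forall w, (0 <= weight w)%R;
  weight_sum1 : (\sum_w weight w = 1)%R;
  start : outcome -> s.-tuple bool;
  step : outcome -> nat -> nat -> s.-tuple bool -> T -> s.-tuple bool;
  accept : outcome -> s.-tuple bool -> bool }.

Section Run.
Variables (R : realType) (T : Type) (s : nat) (A : algorithm R T s).

Definition run_pass (w : outcome A) (i : nat) (m : s.-tuple bool)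
    (sigma : seq T) : s.-tuple bool :=
  foldl (fun m jx => step w i jx.1 m jx.2) m (zip (iota 0 (size sigma)) sigma).

Definition run (p : nat) (sigma : seq T) (w : outcome A) : s.-tuple bool :=
  foldl (fun m i => run_pass w i m sigma) (start w) (iota 0 p).

Definition pr_answer (p : nat) (sigma : seq T) (b : bool) : R :=
  (\sum_(w | accept w (run p sigma w) == b) weight w)%R.

End Run.

Inductive parameter := SolutionSize | VertexCoverSize.

(* kappa is the value of the parameter given to the algorithm along with k. *)
Definition admissible (par : parameter) n (G : graph n) (kappa k : nat)
    : Prop :=
  match par with
  | SolutionSize => kappa = k
  | VertexCoverSize => vertex_cover_number G <= kappa /\ k <= kappa
  end.

Definition solves (R : realType) (Pi : problem) (par : parameter) (M : model)
    (C : forall n, graph n -> Prop) (p : nat) (s : nat -> nat -> nat)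
    (A : forall n kappa k, algorithm R (token n) (s n kappa)) : Prop :=
  forall n (G : graph n) kappa k (sigma : seq (token n)),
    C n G -> admissible par G kappa k -> stream_of M G sigma ->
    (yes_instance Pi G k -> (2 / 3 <= pr_answer (A n kappa k) p sigma true)%R) /\
    (~ yes_instance Pi G k ->
       (2 / 3 <= pr_answer (A n kappa k) p sigma false)%R).

Local Open Scope classical_set_scope.

(* (M, f, p)-hardness of Pi restricted to the graphs in C.  The space s and
   the bound f depend on n and on the parameter kappa; s = o(f) is taken as
   n tends to infinity for each fixed kappa.  This excludes in particular
   every algorithm for which s = o(f) holds uniformly in kappa.            *)
Definition hard (R : realType) (Pi : problem) (par : parameter) (M : model)
    (C : forall n, graph n -> Prop) (f : nat -> nat -> R) (p : nat) : Prop :=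
  forall (s : nat -> nat -> nat)
         (A : forall n kappa k, algorithm R (token n) (s n kappa)),
    (forall kappa, ((fun n => (s n kappa)%:R : R^o) =o_\oo
                    (fun n => f n kappa : R^o))%R) ->
    ~ solves Pi par M C p A.
Arguments hard R Pi par M C f p : clear implicits.

(* Main.v *)
(** Everything already happens for [k = 0], where the question is whether [G] itself
    has a forbidden cycle, and the space bounds come from communication complexity:
    a streaming algorithm, run by Alice up to some point of the stream and by Bob
    afterwards, is a protocol exchanging its memory.

    (I) Alice encodes words [f i] of [r] bits, for [i] among [n = 2^r] indices, by edges
    [a_i - c_(f i)]; Bob closes a cycle exactly when a given bit of a given word is 1.
    This is the one-way INDEX problem on [n log n] bits.
    (II), (III) Set disjointness: in (II) one constant-size cycle per coordinate, two
    edges of which are present according to the players' bits; in (III) two hubs, each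
    player joining the elements of her set to her own hub.

    Both lower bounds rest on the level-one inequality: on a set of density [mu] in the
    cube, the squared biases of the coordinates sum to [O(ln (1 / mu))].  Hence a short
    message or transcript leaves most coordinates nearly unbiased.  For INDEX this is
    the claim.  For disjointness, draw [x, y] with [x_i = 0] or [y_i = 0] decided by a
    coin and the other bit uniform: at a typical coordinate the transcript distributions
    on (0,1) and (1,0) are both close to that on (0,0), hence to each other, and by the
    rectangle property the Hellinger distance between (0,0) and (1,1) is the same as
    between (0,1) and (1,0) (Bar-Yossef, Jayram, Kumar and Sivakumar). *)

Require Import Defs.
From mathcomp Require Import classical_sets filter topology normedtype landau.
From mathcomp Require Import all_boot all_order all_algebra.
From mathcomp Require Import ring lra zify.
From mathcomp Require Import reals sequences exp.
Set Implicit Arguments.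
Unset Strict Implicit.
Unset Printing Implicit Defensive.
Import Order.TTheory GRing.Theory Num.Theory.
Import numFieldNormedType.Exports.
Local Open Scope ring_scope.

(** * The level-one inequality and INDEX *)

Section Bias.
Variable R : realType.

Definition sg (b : bool) : R := if b then 1 else -1.

(** Since [expR (- x) >= 1 - x], the exponential is at most [1 / (1 - x)], and [(1 + x + 2 x^2) (1 -
    x) = 1 + x^2 (1 - 2 x) >= 1]. *)
Lemma expR_le_quad (x : R) : x <= 1 / 2 -> expR x <= 1 + x + 2 * x ^+ 2.
Proof.
move=> hx; have h1 := expR_ge1Dx (- x).
have h2 : expR x * expR (- x) = 1 by rewrite -expRD subrr expR0.
have h3 := expR_gt0 x; have h4 : 0 <= x ^+ 2 * (1 - 2 * x) by rewrite mulr_ge0 ?sqr_ge0 //; lra.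
have h5 : expR x * (1 - x) <= 1 by rewrite -[leRHS]h2 ler_wpM2l ?expR_ge0.
rewrite -(ler_pM2r (_ : 0 < 1 - x)); last by lra.
nra.
Qed.

Lemma expR_sym_le (x : R) : `|x| <= 1 / 2 ->
  expR x + expR (- x) <= 2 * expR (2 * x ^+ 2).
Proof.
rewrite ler_norml => /andP[h1 h2].
have a1 := @expR_le_quad x h2.
have a2 : expR (- x) <= 1 + - x + 2 * (- x) ^+ 2 by apply: expR_le_quad; lra.
have a3 := expR_ge1Dx (2 * x ^+ 2).
rewrite sqrrN in a2; lra.
Qed.

Lemma cube_mgf (I : finType) (lam : I -> R) : (forall i, `|lam i| <= 1 / 2) ->
  \sum_(u : {ffun I -> bool}) expR (\sum_i lam i * sg (u i))
  <= #|{ffun I -> bool}|%:R * expR (2 * \sum_i lam i ^+ 2).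
Proof.
move=> hlam; rewrite [2 * _]mulr_sumr expR_sum.
under [leLHS]eq_bigr do rewrite expR_sum.
rewrite -(bigA_distr_bigA (fun i b => expR (lam i * sg b))).
rewrite card_ffun card_bool natrX -prodr_const -big_split /=.
apply: ler_prod => i _; rewrite big_bool /= mulr1 mulrN1 addr_ge0 ?expR_ge0 //=.
exact: expR_sym_le.
Qed.

Lemma sum_cst (I : finType) (c : R) : \sum_(i : I) c = #|I|%:R * c.
Proof. by rewrite sumr_const mulr_natl. Qed.

Section LevelOne.
(** The coordinates are abstract, bounded and sub-Gaussian, because two spaces occur: the cube for
    INDEX, and pairs of points of the cube for disjointness. *)
Variables (I Om Z : finType) (chi : I -> Om -> R).
Hypothesis chi_bd : forall i w, `|chi i w| <= 1.
Hypothesis mgf : forall lam : I -> R, (forall i, `|lam i| <= 1 / 2) ->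
  \sum_w expR (\sum_i lam i * chi i w) <= #|Om|%:R * expR (2 * \sum_i lam i ^+ 2).
Variable f : Om -> Z.

Definition fib z : R := #|[set w | f w == z]|%:R.
(** [tilt z i / fib z] is the mean of coordinate [i] given the message [z]. *)
Definition tilt z i : R := \sum_(w | f w == z) chi i w.

Lemma fibE z : fib z = \sum_(w | f w == z) 1.
Proof. by rewrite /fib cardsE sumr_const. Qed.

Lemma sum_fib : \sum_z fib z = #|Om|%:R.
Proof.
under eq_bigr do rewrite fibE.
transitivity (\sum_(w : Om) (1 : R)); last by rewrite sumr_const.
by rewrite (partition_big f xpredT).
Qed.

Lemma tilt_le z i : `|tilt z i| <= fib z.
Proof.
rewrite fibE; apply: (le_trans (ler_norm_sum _ _ _)).
by apply: ler_sum => w _; apply: chi_bd.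
Qed.

(* Jensen's inequality for the exponential on the fibre, against its moment
   generating function on the whole space. *)
Lemma level_one z : 0 < fib z ->
  \sum_i tilt z i ^+ 2 / fib z <= 8 * fib z * ln (#|Om|%:R / fib z).
Proof.
move=> m0; set m := fib z.
pose b i := tilt z i / m.
pose B := \sum_i b i ^+ 2.
have bb i : `|b i| <= 1 by rewrite normrM normfV (gtr0_norm m0) ler_pdivrMr // mul1r tilt_le.
have -> : \sum_i tilt z i ^+ 2 / m = m * B.
  rewrite mulr_sumr; apply: eq_bigr => i _; rewrite /b; field; exact: lt0r_neq0.
(* With multipliers [t * b i] the exponent gained is [t B - 2 t^2 B]; it is largest, namely [B / 8],
   at [t = 1 / 4]. *)
have hb i : `|b i / 4| <= 1 / 2 by rewrite normrM normfV (ger0_norm (_ : 0 <= 4)) //; move: (bb i); lra.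
have := mgf hb.
have -> : \sum_i (b i / 4) ^+ 2 = B / 16.
  by rewrite mulr_suml; apply: eq_bigr => i _; field.
move=> up.
have low : m * expR (B / 4) <= \sum_w expR (\sum_i b i / 4 * chi i w).
  rewrite [leRHS](bigID (fun w => f w == z)) /=.
  apply: (@le_trans _ _ (\sum_(w | f w == z) expR (\sum_i b i / 4 * chi i w))); last first.
    by rewrite lerDl sumr_ge0 // => w _; apply: expR_ge0.
  apply: (@le_trans _ _ (\sum_(w | f w == z) expR (B / 4) * (1 + (\sum_i b i / 4 * chi i w - B / 4)))).
    rewrite -mulr_sumr big_split /= -fibE sumrB exchange_big /=.
    under [X in _ - X]eq_bigr do rewrite -[B / 4]mulr1.
    rewrite -mulr_sumr -fibE -/m.
    have -> : \sum_i \sum_(w | f w == z) b i / 4 * chi i w = B / 4 * m.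
      rewrite mulr_suml mulr_suml; apply: eq_bigr => i _.
      rewrite -mulr_sumr -/(tilt z i).
      have -> : tilt z i = b i * m by rewrite /b mulfVK ?lt0r_neq0.
      by field.
    by rewrite subrr addr0 mulrC.
  apply: ler_sum => w _.
  set e := \sum_i _.
  have -> : expR e = expR (B / 4) * expR (e - B / 4) by rewrite -expRD addrCA subrr addr0.
  by rewrite ler_wpM2l ?expR_ge0 ?expR_ge1Dx.
have := le_trans low up.
have -> : B / 4 = B / 8 + 2 * (B / 16) by field.
rewrite expRD mulrA ler_pM2r ?expR_gt0 // mulrC -ler_pdivlMr // => h.
have h0 : 0 < #|Om|%:R / m by apply: lt_le_trans h; apply: expR_gt0.
have : B / 8 <= ln (#|Om|%:R / m) by rewrite -[B / 8]expRK ler_ln // posrE expR_gt0.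
move=> h1; rewrite mulrAC mulrC -mulrA.
by rewrite -subr_ge0; have := m0; rewrite -/m; nra.
Qed.

(** After division by [#|Om|], the bounds of [level_one] add up to 8 times the entropy of the
    message. Bounding it termwise with [ln q <= q] rather than [ln q <= q - 1] costs the extra 1. *)
Lemma bias_sum : \sum_z \sum_i tilt z i ^+ 2 / fib z <= 8 * #|Om|%:R * (ln #|Z|%:R + 1).
Proof.
have [Z0|Zpos] := posnP #|Z|.
  rewrite Z0 ln0 // add0r mulr1 big_pred0 ?mulr_ge0 //.
  by move=> z; have := card0_eq Z0 z; rewrite !inE.
have Zp : (0 : R) < #|Z|%:R by rewrite ltr0n.
suff h z : \sum_i tilt z i ^+ 2 / fib z <= 8 * (fib z * ln #|Z|%:R + #|Om|%:R / #|Z|%:R).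
  apply: (le_trans (ler_sum _ (fun z _ => h z))).
  rewrite -mulr_sumr big_split /= -mulr_suml sum_fib sumr_const -mulrA ler_wpM2l //.
  by rewrite mulrDr mulr1 lerD2l -[leLHS]mulr_natr divfK ?lt0r_neq0.
have [m0|] := ltP 0 (fib z); last first.
  (* The inverse of 0 is 0, so an empty fibre contributes nothing. *)
  move=> h; have -> : fib z = 0 by apply/eqP; rewrite eq_le h ler0n.
  rewrite big1 => [|i _]; last by rewrite invr0 mulr0.
  by rewrite mul0r add0r !mulr_ge0 ?invr_ge0 ?ler0n.
apply: (le_trans (level_one m0)); rewrite -mulrA ler_wpM2l //.
set m := fib z in m0 *.
have Omp : (0 : R) < #|Om|%:R.
  rewrite -sum_fib (bigD1 z) //=; apply: ltr_wpDr => //.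
  by apply: sumr_ge0 => ? _; rewrite ler0n.
have -> : #|Om|%:R / m = #|Z|%:R * (#|Om|%:R / (m * #|Z|%:R)).
  by field; rewrite !lt0r_neq0.
rewrite lnM ?posrE ?divr_gt0 ?mulr_gt0 // mulrDr lerD2l.
have q0 : 0 < #|Om|%:R / (m * #|Z|%:R) by rewrite divr_gt0 ?mulr_gt0.
have -> : #|Om|%:R / #|Z|%:R = m * (#|Om|%:R / (m * #|Z|%:R)).
  by field; rewrite !lt0r_neq0.
rewrite ler_pM2l //; have := expR_ge1Dx (ln (#|Om|%:R / (m * #|Z|%:R))).
by rewrite lnK ?posrE //; lra.
Qed.

End LevelOne.

(** Success 2/3 at every coordinate means correlation at least 1/3 between output and bit. For fixed
    [w] the correlation is at most the mean absolute bias given the message, which [bias_sum]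
    controls through squares. *)
Lemma index_bound (I W Z : finType) (wt : W -> R)
    (msg : W -> {ffun I -> bool} -> Z) (out : W -> Z -> I -> bool) :
  (forall w, 0 <= wt w) -> \sum_w wt w = 1 ->
  (forall u i, 2 / 3 <= \sum_(w | out w (msg w u) i == u i) wt w) ->
  #|I|%:R <= 72 * (ln #|Z|%:R + 1) :> R.
Proof.
move=> wt0 wt1 succ; set U := ({ffun I -> bool}).
pose chi i (u : U) : R := sg (u i).
have chi_bd i u : `|chi i u| <= 1 by rewrite /chi /sg; case: ifP; rewrite ?normrN normr1.
pose gain w i : R := \sum_u sg (out w (msg w u) i) * chi i u.
have gainE w i : gain w i = \sum_z sg (out w z i) * tilt chi (msg w) z i.
  rewrite /gain (partition_big (msg w) xpredT) //=; apply: eq_bigr => z _.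
  by rewrite mulr_sumr; apply: eq_bigr => u /eqP ->.
have gain_le w : \sum_i gain w i <= #|U|%:R * (#|I|%:R / 6 + 12 * (ln #|Z|%:R + 1)).
  (* From [0 <= (m - 3 |c|)^2]. The share 1/6 is half of the correlation 1/3, and 72 is 6 times the
     12 obtained here. *)
  have h z i : sg (out w z i) * tilt chi (msg w) z i <=
      fib (msg w) z / 6 + 3 / 2 * (tilt chi (msg w) z i ^+ 2 / fib (msg w) z).
    set c := tilt _ _ _ _; set m := fib _ _.
    have cm : `|c| <= m by apply: tilt_le.
    apply: (@le_trans _ _ `|c|).
      by rewrite /sg; case: ifP => _; rewrite ?mulN1r ?mul1r ?ler_norm // lerNl lerNnormlW.
    have [m0|m0] := ltP 0 m; last first.
      rewrite (le_trans cm) // (le_anti (_ : m <= 0 <= m)) ?m0 ?ler0n //.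
      by rewrite invr0 !mulr0 mul0r addr0.
    rewrite -(ler_pM2r m0) mulrDl -[3 / 2 * _ * m]mulrA divfK ?lt0r_neq0 //.
    by rewrite -(real_normK (num_real c)); move: `|c| => {cm}c; have := sqr_ge0 (m - 3 * c); nra.
  under eq_bigr do rewrite gainE.
  rewrite exchange_big /=.
  apply: (le_trans (ler_sum _ (fun z _ => ler_sum _ (fun i _ => h z i)))).
  under eq_bigr do rewrite big_split /= sumr_const -mulr_sumr.
  rewrite big_split /= -mulr_sumr.
  have := bias_sum chi_bd (@cube_mgf I) (msg w).
  under [X in _ -> X + _ <= _]eq_bigr do rewrite -[_ *+ _]mulr_natr.
  rewrite -mulr_suml -mulr_suml sum_fib -/U.
  by lra.
have low i u : 1 / 3 <= \sum_w wt w * (sg (out w (msg w u) i) * chi i u).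
  rewrite (bigID (fun w => out w (msg w u) i == u i)) /=.
  rewrite (eq_bigr wt); last by move=> w /eqP ->; rewrite /chi /sg; case: (u i); rewrite ?mulrNN !mulr1.
  rewrite [X in _ + X](eq_bigr (fun w => - wt w)); last first.
    by move=> w; rewrite /chi /sg; case: (u i); case: (out _ _ _) => //= _; rewrite ?mulr1 ?mul1r ?mulrN1.
  rewrite sumrN; have := succ u i; move: wt1.
  rewrite (bigID (fun w => out w (msg w u) i == u i)) /=; lra.
have U0 : (0 : R) < #|U|%:R by rewrite ltr0n; apply/card_gt0P; exists [ffun=> true].
have : \sum_(i : I) \sum_(u : U) (1 / 3 : R) <= \sum_w wt w * \sum_i gain w i.
  have -> : \sum_w wt w * \sum_i gain w i =
      \sum_i \sum_u \sum_w wt w * (sg (out w (msg w u) i) * chi i u).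
    under eq_bigr do rewrite mulr_sumr.
    rewrite exchange_big /=; apply: eq_bigr => i _.
    under eq_bigr do rewrite mulr_sumr.
    by rewrite exchange_big.
  by apply: ler_sum => i _; apply: ler_sum => u _; apply: low.
move=> /le_trans /(_ (ler_sum _ (fun w _ => ler_wpM2l (wt0 w) (gain_le w)))).
have -> : \sum_(i : I) \sum_(u : U) (1 / 3 : R) = #|U|%:R * (#|I|%:R / 3).
  by rewrite !sum_cst; ring.
by rewrite -[X in _ <= X -> _]mulr_suml wt1 mul1r ler_pM2l //; lra.
Qed.

End Bias.

(** * Set disjointness *)

Section Disjointness.
Variables (R : realType) (I : finType).
Local Notation U := {ffun I -> bool}.

Definition upd (i : I) (b : bool) (x : U) : U := [ffun j => if j == i then b else x j].
(** The mask [d] is the coin of the hard distribution: Alice gets [masked d u], Bob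
    [masked (flip d) v], a disjoint pair. *)
Definition masked (d u : U) : U := [ffun j => d j && u j].
Definition flip (d : U) : U := [ffun j => ~~ d j].

Lemma upd_id i (x : U) : upd i (x i) x = x.
Proof. by apply/ffunP => j; rewrite ffunE; case: eqP => // ->. Qed.

Lemma upd_masked i b c (d u : U) : upd i b (masked (upd i c d) u) = upd i b (masked d u).
Proof. by apply/ffunP => j; rewrite !ffunE; case: eqP. Qed.

Lemma flip_upd i c (d : U) : flip (upd i c d) = upd i (~~ c) (flip d).
Proof. by apply/ffunP => j; rewrite !ffunE; case: eqP. Qed.

Lemma masked_upd_in i b (d u : U) : d i -> masked d (upd i b u) = upd i b (masked d u).
Proof. by move=> di; apply/ffunP => j; rewrite !ffunE; case: eqP => // ->; rewrite di. Qed.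

Lemma masked_out i (d u : U) : ~~ d i -> masked d u = upd i false (masked d u).
Proof. by move=> /negbTE di; apply/ffunP => j; rewrite !ffunE; case: eqP => // ->; rewrite di. Qed.

Lemma sum_upd i (F : U -> R) :
  2 * \sum_u F u = \sum_u (F (upd i true u) + F (upd i false u)).
Proof.
pose tog (u : U) := upd i (~~ u i) u.
have togK : involutive tog.
  by move=> u; apply/ffunP => j; rewrite !ffunE eqxx negbK; case: eqP => // ->.
rewrite mulr_natl mulr2n [X in _ + X](reindex_inj (inv_inj togK)) /= -big_split /=.
apply: eq_bigr => u _; rewrite -{1}(upd_id i u) /tog.
by case: (u i) => //=; rewrite addrC.
Qed.

(** [(p - q)^2] is [(sqrt p - sqrt q)^2 (sqrt p + sqrt q)^2], whose last factor is at least [p + q].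
    The halves are there to match [tilt] and [fib]. *)
Lemma sqrt_dist_le (p q : R) : 0 <= p -> 0 <= q ->
  (Num.sqrt p - Num.sqrt q) ^+ 2 <= 2 * (((p - q) / 2) ^+ 2 / ((p + q) / 2)).
Proof.
move=> p0 q0; have [pq0|pq0] := ltP 0 (p + q); last first.
  have -> : p = 0 by lra. have -> : q = 0 by lra.
  by rewrite !subrr !expr2 !(mul0r, mulr0).
move: (sqr_sqrtr p0) (sqr_sqrtr q0) (sqrtr_ge0 p) (sqrtr_ge0 q) pq0.
move: (Num.sqrt p) (Num.sqrt q) => a b <- <- a0 b0 ab0.
have -> : 2 * (((a ^+ 2 - b ^+ 2) / 2) ^+ 2 / ((a ^+ 2 + b ^+ 2) / 2)) =
  (a - b) ^+ 2 * ((a + b) ^+ 2 / (a ^+ 2 + b ^+ 2)) by field; rewrite lt0r_neq0.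
by rewrite ler_peMr ?sqr_ge0 // ler_pdivlMr // mul1r; have := mulr_ge0 a0 b0; nra.
Qed.

(* The cut-and-paste property of Hellinger distances: [a0 b1] is far from
   [a1 b0] exactly when [a0 b0] is far from [a1 b1]. *)
Lemma cut_and_paste (Z : finType) (a0 a1 b0 b1 : Z -> R) (acc : pred Z) (K : R) :
  \sum_z (a0 z * b0 z) ^+ 2 = K -> \sum_z (a0 z * b1 z) ^+ 2 = K ->
  \sum_z (a1 z * b0 z) ^+ 2 = K -> \sum_z (a1 z * b1 z) ^+ 2 = K ->
  \sum_(z | acc z) (a0 z * b0 z) ^+ 2 - \sum_(z | acc z) (a1 z * b1 z) ^+ 2 <=
  12 * (\sum_z (a0 z * b1 z - a0 z * b0 z) ^+ 2 +
        \sum_z (a1 z * b0 z - a0 z * b0 z) ^+ 2) + K / 6.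
Proof.
move=> h00 h01 h10 h11; rewrite -sumrB big_mkcond /=.
(* Both squares have the cross term [a0 a1 b0 b1], and all four square sums equal [K]. *)
have cp : \sum_z (a0 z * b0 z - a1 z * b1 z) ^+ 2 = \sum_z (a0 z * b1 z - a1 z * b0 z) ^+ 2.
  have -> : \sum_z (a0 z * b0 z - a1 z * b1 z) ^+ 2 =
      \sum_z ((a0 z * b1 z - a1 z * b0 z) ^+ 2 + ((a0 z * b0 z) ^+ 2 + (a1 z * b1 z) ^+ 2
        - (a0 z * b1 z) ^+ 2 - (a1 z * b0 z) ^+ 2)).
    by apply: eq_bigr => z _; ring.
  by rewrite big_split /= !sumrB big_split /= h00 h01 h10 h11; ring.
have tri : \sum_z (a0 z * b1 z - a1 z * b0 z) ^+ 2 <=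
    2 * (\sum_z (a0 z * b1 z - a0 z * b0 z) ^+ 2 + \sum_z (a1 z * b0 z - a0 z * b0 z) ^+ 2).
  rewrite -big_split mulr_sumr /=; apply: ler_sum => z _.
  rewrite -subr_ge0; set x := a0 z * b1 z; set y := a1 z * b0 z; set w := a0 z * b0 z.
  by have := sqr_ge0 (x + y - 2 * w); nra.
(* For [D = x - y] and [S = x + y], [D S <= 6 D^2 + S^2 / 24] and [S^2 <= 2 (x^2 + y^2)]. The error
   [K / 6] is half of the gap 1/3 of a correct protocol. *)
have : \sum_z (if acc z then (a0 z * b0 z) ^+ 2 - (a1 z * b1 z) ^+ 2 else 0) <=
    \sum_z (6 * (a0 z * b0 z - a1 z * b1 z) ^+ 2 + ((a0 z * b0 z) ^+ 2 + (a1 z * b1 z) ^+ 2) / 12).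
  apply: ler_sum => z _; move: (a0 z * b0 z) (a1 z * b1 z) => x y.
  case: (acc z); first by have := sqr_ge0 (12 * (x - y) - (x + y)); have := sqr_ge0 (x - y); nra.
  by have := sqr_ge0 (x - y); have := sqr_ge0 x; have := sqr_ge0 y; lra.
rewrite big_split /= -mulr_sumr -mulr_suml big_split /= h00 h11 cp; lra.
Qed.

(** * Transcripts of a deterministic protocol on random disjoint inputs *)

Section Deterministic.
Variables (Z : finType) (tr : U -> U -> Z) (cA cB : Z -> pred U) (acc : pred Z).
Hypothesis rect : forall x y z, (tr x y == z) = cA z x && cB z y.

Definition pairT (d : U) (w : U * U) : Z := tr (masked d w.1) (masked (flip d) w.2).
(** The bit, as a sign, that the mask lets through at [i]; the other player holds 0 there. *)
Definition coord (d : U) (i : I) (w : U * U) : R := sg R (if d i then w.1 i else w.2 i).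

Lemma coord_bd d i w : `|coord d i w| <= 1.
Proof. by rewrite /coord /sg; case: ifP; rewrite ?normrN normr1. Qed.

Lemma sum_prod (F G : U -> R) : \sum_w F w.1 * G w.2 = (\sum_u F u) * \sum_u G u.
Proof.
by rewrite big_distrlr pair_bigA.
Qed.

(** Each coordinate reads one of two independent points, so [lam] splits into two parts with
    disjoint supports and the sum factors. *)
Lemma coord_mgf d (lam : I -> R) : (forall i, `|lam i| <= 1 / 2) ->
  \sum_w expR (\sum_i lam i * coord d i w) <= #|{: U * U}|%:R * expR (2 * \sum_i lam i ^+ 2).
Proof.
move=> h; pose l1 i := if d i then lam i else 0; pose l2 i := if d i then 0 else lam i.
have h1 i : `|l1 i| <= 1 / 2 by rewrite /l1; case: ifP => // _; rewrite normr0; lra.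
have h2 i : `|l2 i| <= 1 / 2 by rewrite /l2; case: ifP => // _; rewrite normr0; lra.
have -> : \sum_w expR (\sum_i lam i * coord d i w) =
    \sum_(w : U * U) expR (\sum_i l1 i * sg R (w.1 i)) * expR (\sum_i l2 i * sg R (w.2 i)).
  apply: eq_bigr => w _; rewrite -expRD -big_split /=; congr expR.
  by apply: eq_bigr => i _; rewrite /coord /l1 /l2; case: (d i); rewrite mul0r ?addr0 ?add0r.
rewrite (sum_prod (fun u => expR (\sum_i l1 i * sg R (u i))) (fun u => expR (\sum_i l2 i * sg R (u i)))).
have -> : \sum_i lam i ^+ 2 = \sum_i l1 i ^+ 2 + \sum_i l2 i ^+ 2.
  rewrite -big_split /=; apply: eq_bigr => i _; rewrite /l1 /l2.
  by case: (d i); rewrite [0 ^+ 2]expr0n ?addr0 ?add0r.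
rewrite mulrDr expRD card_prod natrM mulrACA.
by apply: ler_pM; rewrite ?cube_mgf // sumr_ge0 // => *; rewrite expR_ge0.
Qed.

(** Up to the factor [#|{: U * U}|], the mean over transcripts of the squared conditional bias of
    the bit at [i]. *)
Definition energy (d : U) (i : I) : R :=
  \sum_z tilt (coord d) (pairT d) z i ^+ 2 / fib R (pairT d) z.

Lemma energy_sum d : \sum_i energy d i <= 8 * #|{: U * U}|%:R * (ln #|Z|%:R + 1).
Proof.
rewrite /energy exchange_big /=.
by apply: bias_sum; [apply: coord_bd | apply: coord_mgf].
Qed.

Section Coordinate.
Variables (i : I) (d : U).
(** By the rectangle property, [alpha a z * beta b z] draws reach [z] when the bits at [i] are set
    to [(a, b)]: the product form that [cut_and_paste] needs. *)
Let alpha b z : R := \sum_(u | cA z (upd i b (masked d u))) 1.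
Let beta b z : R := \sum_(u | cB z (upd i b (masked (flip d) u))) 1.
Definition swapped a b (w : U * U) : Z :=
  tr (upd i a (masked d w.1)) (upd i b (masked (flip d) w.2)).

Lemma sum_pred_prod (p q : pred U) (F G : U -> R) :
  \sum_(w | p w.1 && q w.2) F w.1 * G w.2 = (\sum_(u | p u) F u) * \sum_(u | q u) G u.
Proof.
rewrite big_mkcond [X in _ = X * _]big_mkcond [X in _ = _ * X]big_mkcond /= -sum_prod.
by apply: eq_bigr => w _; case: (p _); case: (q _); rewrite ?mul0r ?mulr0.
Qed.

Lemma alpha_ge0 b z : 0 <= alpha b z. Proof. exact: sumr_ge0. Qed.
Lemma beta_ge0 b z : 0 <= beta b z. Proof. exact: sumr_ge0. Qed.

Lemma count_swapped a b z : \sum_(w | swapped a b w == z) 1 = alpha a z * beta b z.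
Proof.
rewrite -(sum_pred_prod _ _ (fun=> 1) (fun=> 1)).
by apply: eq_big => [w|w _]; rewrite ?mulr1 // /swapped rect.
Qed.

Lemma fib_pairT d' z : fib R (pairT d') z =
  (\sum_(u | cA z (masked d' u)) 1) * \sum_(u | cB z (masked (flip d') u)) 1.
Proof.
rewrite fibE -(sum_pred_prod _ _ (fun=> 1) (fun=> 1)).
by apply: eq_big => [w|w _]; rewrite ?mulr1 // /pairT rect.
Qed.

Lemma tilt_pairT d' z : tilt (coord d') (pairT d') z i =
  if d' i then (\sum_(u | cA z (masked d' u)) sg R (u i)) * \sum_(u | cB z (masked (flip d') u)) 1
  else (\sum_(u | cA z (masked d' u)) 1) * \sum_(u | cB z (masked (flip d') u)) sg R (u i).
Proof.
case: ifP => di.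
  rewrite -(sum_pred_prod _ _ (fun u => sg R (u i)) (fun=> 1)).
  by apply: eq_big => [w|w _]; rewrite /pairT ?rect // /coord di mulr1.
rewrite -(sum_pred_prod _ _ (fun=> 1) (fun u => sg R (u i))).
by apply: eq_big => [w|w _]; rewrite /pairT ?rect // /coord di mul1r.
Qed.

(** The mask passes bit [i] of [u], so [sum_upd] splits both sums by its value; they are one
    player's factors of [fib] and [tilt]. *)
Lemma halves (c : pred U) (d' : U) : d' i ->
  let s b : R := \sum_(u | c (upd i b (masked d' u))) 1 in
  (\sum_(u | c (masked d' u)) 1 = (s true + s false) / 2) /\
  (\sum_(u | c (masked d' u)) sg R (u i) = (s true - s false) / 2).
Proof.
have n2 : (2 : R) != 0 by rewrite pnatr_eq0.
move=> di s; split; apply: (mulfI n2) => /=.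
  rewrite [RHS]mulrC divfK ?n2 // [in LHS]big_mkcond (sum_upd i) /s.
  rewrite [X in _ = X + _]big_mkcond [X in _ = _ + X]big_mkcond /=.
  by rewrite -big_split; apply: eq_bigr => u _; rewrite !masked_upd_in.
rewrite [RHS]mulrC divfK ?n2 // [in LHS]big_mkcond (sum_upd i) /s.
rewrite [X in _ = X - _]big_mkcond [X in _ = _ - X]big_mkcond /=.
rewrite -sumrB; apply: eq_bigr => u _; rewrite !masked_upd_in // !ffunE eqxx /sg.
by do 2 case: ifP => _; rewrite ?oppr0.
Qed.

Lemma sqrt_dist_mul_le (a1 a0 b : R) : 0 <= a1 -> 0 <= a0 -> 0 <= b ->
  (Num.sqrt a1 * Num.sqrt b - Num.sqrt a0 * Num.sqrt b) ^+ 2 <=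
  2 * (((a1 - a0) / 2 * b) ^+ 2 / ((a1 + a0) / 2 * b)).
Proof.
move=> h1 h0 hb; rewrite -!sqrtrM //.
apply: (le_trans (sqrt_dist_le _ _)); rewrite ?mulr_ge0 //.
by rewrite -mulrBl -mulrDl !(mulrAC _ b).
Qed.

(** When [d] holds at [i], Bob has 0 there and Alice a uniform bit, whose bias given the transcript
    measures, by [sqrt_dist_le], the distance between inputs (1,0) and (0,0). *)
Lemma energy_true : \sum_z (Num.sqrt (alpha true z) * Num.sqrt (beta false z)
     - Num.sqrt (alpha false z) * Num.sqrt (beta false z)) ^+ 2 <= 2 * energy (upd i true d) i.
Proof.
rewrite mulr_sumr; apply: ler_sum => z _; rewrite fib_pairT tilt_pairT ffunE eqxx.
have di : upd i true d i by rewrite ffunE eqxx.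
have [-> ->] := halves (cA z) di.
have nd u : masked (flip (upd i true d)) u = upd i false (masked (flip d) u).
  by rewrite (@masked_out i) ?flip_upd ?upd_masked // ffunE eqxx.
have -> : \sum_(u | cB z (masked (flip (upd i true d)) u)) 1 = beta false z.
  by apply: eq_bigl => u; rewrite nd.
have ae b : \sum_(u | cA z (upd i b (masked (upd i true d) u))) 1 = alpha b z.
  by apply: eq_bigl => u; rewrite upd_masked.
by rewrite !ae sqrt_dist_mul_le ?alpha_ge0 ?beta_ge0.
Qed.

Lemma energy_false : \sum_z (Num.sqrt (alpha false z) * Num.sqrt (beta true z)
     - Num.sqrt (alpha false z) * Num.sqrt (beta false z)) ^+ 2 <= 2 * energy (upd i false d) i.
Proof.
rewrite mulr_sumr; apply: ler_sum => z _; rewrite fib_pairT tilt_pairT ffunE eqxx.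
have di : flip (upd i false d) i by rewrite !ffunE eqxx.
have [-> ->] := halves (cB z) di.
have -> : \sum_(u | cA z (masked (upd i false d) u)) 1 = alpha false z.
  by apply: eq_bigl => u; rewrite (@masked_out i) ?upd_masked // ffunE eqxx.
have be b : \sum_(u | cB z (upd i b (masked (flip (upd i false d)) u))) 1 = beta b z.
  by apply: eq_bigl => u; rewrite flip_upd upd_masked.
rewrite !be ![Num.sqrt (alpha _ _) * _]mulrC ![alpha _ _ * _]mulrC.
by rewrite sqrt_dist_mul_le ?alpha_ge0 ?beta_ge0.
Qed.

(** This is [cut_and_paste] for the square roots of the counts; 24 is 12 times the factor 2 of
    [energy_true] and [energy_false]. *)
Lemma swapped_gap :
  \sum_(w | acc (swapped false false w)) 1 - \sum_(w | acc (swapped true true w)) 1 <=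
  24 * (energy (upd i true d) i + energy (upd i false d) i) + #|{: U * U}|%:R / 6.
Proof.
have sq a b z : (Num.sqrt (alpha a z) * Num.sqrt (beta b z)) ^+ 2 = alpha a z * beta b z.
  by rewrite exprMn !sqr_sqrtr ?alpha_ge0 ?beta_ge0.
have tot a b : \sum_z (Num.sqrt (alpha a z) * Num.sqrt (beta b z)) ^+ 2 = #|{: U * U}|%:R.
  under eq_bigr do rewrite sq -count_swapped.
  transitivity (\sum_(w : U * U) (1 : R)); last by rewrite sumr_const.
  by rewrite (partition_big (swapped a b) xpredT).
have accE a b : \sum_(w | acc (swapped a b w)) 1 =
    \sum_(z | acc z) (Num.sqrt (alpha a z) * Num.sqrt (beta b z)) ^+ 2.
  under [RHS]eq_bigr do rewrite sq -count_swapped.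
  rewrite (partition_big (swapped a b) acc) //=; apply: eq_bigr => z az.
  by apply: eq_bigl => w; case: eqP => [->|]; rewrite ?andbF ?az.
rewrite !accE.
apply: (le_trans (cut_and_paste _ (tot _ _) (tot _ _) (tot _ _) (tot _ _))).
by have := energy_true; have := energy_false; lra.
Qed.

End Coordinate.

(** Forcing the bit of [d] at [i] to both values counts every mask twice, hence 48 = 24 * 2;
    [energy_sum] brings the factor 8 in 384 = 48 * 8. *)
Lemma sum_swapped_gap :
  \sum_i \sum_d (\sum_(w | acc (swapped i d false false w)) 1 -
                 \sum_(w | acc (swapped i d true true w)) 1) <=
  #|U|%:R * #|{: U * U}|%:R * (384 * (ln #|Z|%:R + 1) + #|I|%:R / 6) :> R.
Proof.
apply: (le_trans (ler_sum _ (fun i _ => ler_sum _ (fun d _ => swapped_gap i d)))).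
have -> : \sum_i \sum_d (24 * (energy (upd i true d) i + energy (upd i false d) i) +
      #|{: U * U}|%:R / 6) =
    48 * (\sum_d \sum_i energy d i) + #|U|%:R * #|{: U * U}|%:R * (#|I|%:R / 6).
  rewrite [X in 48 * X]exchange_big [48 * _]mulr_sumr /=.
  have -> : #|U|%:R * #|{: U * U}|%:R * (#|I|%:R / 6) = \sum_(i : I) #|U|%:R * (#|{: U * U}|%:R / 6) :> R.
    by rewrite sumr_const -mulr_natr; ring.
  rewrite -big_split; apply: eq_bigr => i _ /=.
  rewrite big_split /= -mulr_sumr -(sum_upd i (fun d => energy d i)) sumr_const -mulr_natr; ring.
have : \sum_d \sum_i energy d i <= #|U|%:R * (8 * #|{: U * U}|%:R * (ln #|Z|%:R + 1)).
  by rewrite mulr_natl -sumr_const; apply: ler_sum => d _; apply: energy_sum.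
by lra.
Qed.

End Deterministic.

Lemma disjointness_bound (W Z : finType) (wt : W -> R) (tr : W -> U -> U -> Z)
    (cA cB : W -> Z -> pred U) (acc : W -> pred Z) :
  (forall w, 0 <= wt w) -> \sum_w wt w = 1 ->
  (forall w x y z, (tr w x y == z) = cA w z x && cB w z y) ->
  (forall x y : U, (forall i, ~~ (x i && y i)) -> 2 / 3 <= \sum_(w | acc w (tr w x y)) wt w) ->
  (forall x y : U, (exists i, x i && y i) -> 2 / 3 <= \sum_(w | ~~ acc w (tr w x y)) wt w) ->
  #|I|%:R <= 2304 * (ln #|Z|%:R + 1) :> R.
Proof.
move=> wt0 wt1 rect yes no.
pose hit w i d a b : R := \sum_(v : U * U | acc w (swapped (tr w) i d a b v)) 1.
(* Bits (0,0) at [i] make the inputs disjoint, bits (1,1) make them meet: acceptance is at least 2/3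
   and at most 1/3. Against the error 1/6 this leaves [#|I| / 6], whence 2304 = 6 * 384. *)
have gap i d : #|{: U * U}|%:R / 3 <= \sum_w wt w * (hit w i d false false - hit w i d true true).
  pose pr a b v := \sum_(w | acc w (swapped (tr w) i d a b v)) wt w.
  have -> : \sum_w wt w * (hit w i d false false - hit w i d true true) =
      \sum_(v : U * U) (pr false false v - pr true true v).
    under eq_bigr do rewrite mulrBr.
    rewrite !sumrB; congr (_ - _); rewrite /pr [RHS](exchange_big_dep xpredT) //=;
      apply: eq_bigr => w _; by rewrite mulr_sumr; apply: eq_bigr => v _; rewrite mulr1.
  rewrite mulr_natl -[_ *+ _]sumr_const; apply: ler_sum => v _.
  have h0 : 2 / 3 <= pr false false v.
    by apply: yes => j; rewrite !ffunE; case: eqP => //; case: (d j); rewrite ?andbF.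
  have h1 : 2 / 3 <= \sum_(w | ~~ acc w (swapped (tr w) i d true true v)) wt w.
    by apply: no; exists i; rewrite !ffunE eqxx.
  have := wt1; rewrite (bigID (fun w => acc w (swapped (tr w) i d true true v))) /= -/(pr true true v).
  by lra.
have U0 : (0 : R) < #|U|%:R * #|{: U * U}|%:R.
  by rewrite mulr_gt0 // ltr0n; apply/card_gt0P; [exists [ffun=> true] | exists ([ffun=> true], [ffun=> true])].
have := ler_sum (index_enum W) (P := xpredT) (fun w _ => ler_wpM2l (wt0 w) (sum_swapped_gap (acc w) (rect w))).
have wtC (C : R) : \sum_w wt w * C = C by rewrite -mulr_suml wt1 mul1r.
rewrite wtC.
have -> : \sum_w wt w * (\sum_i \sum_d (hit w i d false false - hit w i d true true)) =
    \sum_i \sum_d \sum_w wt w * (hit w i d false false - hit w i d true true).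
  under eq_bigr do rewrite mulr_sumr.
  rewrite exchange_big /=; apply: eq_bigr => i _.
  under eq_bigr do rewrite mulr_sumr.
  by rewrite exchange_big.
move=> /(le_trans (ler_sum _ (fun i _ => ler_sum _ (fun d _ => gap i d)))).
have -> : \sum_(i : I) \sum_(d : U) (#|{: U * U}|%:R / 3 : R) =
    #|U|%:R * #|{: U * U}|%:R * (#|I|%:R / 3).
  by rewrite !sum_cst !mulrA [_ * #|U|%:R]mulrC -!mulrA; congr (_ * _); rewrite mulrCA mulrA.
by move: (_ * #|{: U * U}|%:R) U0 => K K0; rewrite (ler_pM2l K0); lra.
Qed.

End Disjointness.

(** * Streaming algorithms as protocols *)

Section Protocol.
Variables (S : finType) (X Y : Type) (fA : nat -> S -> X -> S) (fB : nat -> S -> Y -> S).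

Definition proto_run (p : nat) (m : S) x y : S :=
  foldl (fun m i => fB i (fA i m x) y) m (iota 0 p).

Fixpoint trace (q i : nat) (m : S) x y : seq (S * S) :=
  if q is q'.+1 then
    let a := fA i m x in let b := fB i a y in (a, b) :: trace q' i.+1 b x y
  else [::].

(** Each player can check her own messages from the transcript and her own input; a transcript
    occurs when both checks pass, which is the rectangle property. *)
Fixpoint legalA (i : nat) (m : S) (t : seq (S * S)) x : bool :=
  if t is (a, b) :: t' then (a == fA i m x) && legalA i.+1 b t' x else true.

Fixpoint legalB (i : nat) (t : seq (S * S)) y : bool :=
  if t is (a, b) :: t' then (b == fB i a y) && legalB i.+1 t' y else true.

Lemma size_trace q i m x y : size (trace q i m x y) == q.
Proof. by elim: q i m => //= q IH i m; rewrite eqSS. Qed.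

Lemma trace_rect q i m t x y : size t = q ->
  (trace q i m x y == t) = legalA i m t x && legalB i t y.
Proof.
elim: q i m t => [|q IH] i m [|[a b] t] //= [st].
rewrite eqseq_cons xpair_eqE ![fA i m x == a]eq_sym ![_ == b]eq_sym.
case: eqP => //= ->; case: (b =P _) => [->|_] /=; last by rewrite andbF.
exact: IH.
Qed.

Lemma last_trace q i m x y :
  foldl (fun m i => fB i (fA i m x) y) m (iota i q) = last m (map snd (trace q i m x y)).
Proof. by elim: q i m => //= q IH i m; rewrite IH. Qed.

End Protocol.

Lemma ln_card_tuple (R : realType) (S : finType) p : (0 < #|S|)%N ->
  ln #|{: p.-tuple (S * S)}|%:R = 2 * p%:R * ln #|S|%:R :> R.
Proof.
move=> S0; have S0' : (0 : R) < #|S|%:R by rewrite ltr0n.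
rewrite card_tuple card_prod natrX natrM lnXn ?mulr_gt0 // lnM ?posrE //.
by rewrite -mulr_natr; ring.
Qed.

Lemma protocol_disjointness (R : realType) (I W S : finType) (wt : W -> R) (p : nat)
    (st : W -> S) (fA fB : W -> nat -> S -> {ffun I -> bool} -> S) (acc : W -> pred S) :
  (forall w, 0 <= wt w) -> \sum_w wt w = 1 ->
  (forall x y : {ffun I -> bool}, (forall i, ~~ (x i && y i)) ->
    2 / 3 <= \sum_(w | acc w (proto_run (fA w) (fB w) p (st w) x y)) wt w) ->
  (forall x y : {ffun I -> bool}, (exists i, x i && y i) ->
    2 / 3 <= \sum_(w | ~~ acc w (proto_run (fA w) (fB w) p (st w) x y)) wt w) ->
  #|I|%:R <= 2304 * (2 * p%:R * ln #|S|%:R + 1) :> R.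
Proof.
move=> wt0 wt1 yes no.
have S0 : (0 < #|S|)%N.
  (* The weights sum to 1, so an outcome exists, and its start state inhabits [S]. *)
  case: (pickP (fun _ : W => true)) => [w _|W0]; first by apply/card_gt0P; exists (st w).
  by move: wt1; rewrite big_pred0 // => /eqP; rewrite eq_sym oner_eq0.
rewrite -ln_card_tuple //.
pose tr w x y : p.-tuple (S * S) := Tuple (size_trace (fA w) (fB w) p 0 (st w) x y).
(* The answer is read off Bob's last message, or off the start state if there is no pass. *)
pose fin w (t : p.-tuple (S * S)) := acc w (last (st w) (map snd t)).
have finE w x y : fin w (tr w x y) = acc w (proto_run (fA w) (fB w) p (st w) x y).
  by rewrite /fin /proto_run (last_trace (fA w) (fB w)).
apply: (disjointness_bound (acc := fin) (tr := tr)
  (cA := fun w t x => legalA (fA w) 0 (st w) t x)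
  (cB := fun w t y => legalB (fB w) 0 t y) wt0 wt1).
- by move=> w x y z; rewrite -(trace_rect (fA w) (fB w) _ _ x y (size_tuple z)) -val_eqE.
- by move=> x y /yes; under eq_bigl do rewrite -finE.
- by move=> x y /no; under eq_bigl do rewrite -finE.
Qed.

(** * Streams split between two players *)

Section Streams.
Variables (T : finType) (X Y : Type) (e : X -> Y -> rel T).
Hypothesis e_sym : forall x y, symmetric (e x y).
Hypothesis e_irr : forall x y, irreflexive (e x y).

Definition instance x y : graph #|T| :=
  @Graph #|T| (fun u v => e x y (enum_val u) (enum_val v))
    (fun u v => e_sym x y (enum_val u) (enum_val v))
    (fun u => e_irr x y (enum_val u)).

Variables (M : model) (isA : pred T).
(* What a player reveals may depend on her own input only; in the vertex arrival
   model the first player never reveals an edge towards the second one. *)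
Hypothesis alice_local : forall x y y' t u,
  isA t -> (M = VA -> isA u) -> e x y t u = e x y' t u.
Hypothesis bob_local : forall x x' y t u, ~~ isA t -> e x y t u = e x' y t u.

Definition alice : seq 'I_#|T| := [seq v <- enum 'I_#|T| | isA (enum_val v)].
Definition bob : seq 'I_#|T| := [seq v <- enum 'I_#|T| | ~~ isA (enum_val v)].

Definition block (G : graph #|T|) (v : 'I_#|T|) : seq (token #|T|) :=
  Expose v :: [seq Edge v u | u <- revealed M G (alice ++ bob) v].

Variables (x0 : X) (y0 : Y).
(** The dummies [y0] and [x0] make each half a function of its owner's input alone; locality makes
    their choice irrelevant. *)
Definition streamA x := flatten [seq block (instance x y0) v | v <- alice].
Definition streamB y := flatten [seq block (instance x0 y) v | v <- bob].

(** As Alice's vertices come first, in the VA model they reveal edges among themselves only; hence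
    [isA u] in [alice_local]. *)
Lemma stream_instance x y : stream_of M (instance x y) (streamA x ++ streamB y).
Proof.
exists (alice ++ bob), (revealed M (instance x y) (alice ++ bob)); split => //.
  exact/permPl/perm_filterC.
rewrite map_cat flatten_cat /streamA /streamB; congr (flatten _ ++ flatten _).
  apply/eq_in_map => v; rewrite mem_filter => /andP[Av _].
  rewrite /block; congr (_ :: map _ _); rewrite /revealed.
  have := alice_local; case: (M) => loc; first by apply: eq_filter => u; apply: loc.
  apply: eq_in_filter => u; rewrite index_cat mem_filter Av mem_enum /= take_cat index_mem.
  rewrite mem_filter Av mem_enum /= => /mem_take; rewrite mem_filter => /andP[Au _].
  exact: loc.
apply/eq_in_map => v; rewrite mem_filter => /andP[Av _].
rewrite /block; congr (_ :: map _ _); rewrite /revealed.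
by case: (M); apply: eq_filter => u; apply: bob_local.
Qed.

Lemma size_streamA x : (size (streamA x) <= #|T| * #|T|.+1)%N.
Proof.
rewrite size_flatten /shape -map_comp sumnE big_map.
apply: (@leq_trans (\sum_(v <- alice) #|T|.+1)).
  apply: leq_sum => v _ /=; rewrite ltnS size_map.
  have svs : size (alice ++ bob) = #|T|.
    by rewrite /alice /bob (perm_size (permEl (perm_filterC _ _))) size_enum_ord.
  rewrite -[leqRHS]svs /revealed; case: (M); rewrite size_filter.
    exact: count_size.
  by apply: (leq_trans (count_size _ _)); rewrite size_take_min geq_minr.
rewrite big_const_seq iter_addn_0 mulnC leq_mul2r count_predT /=.
by rewrite size_filter (leq_trans (count_size _ _)) // size_enum_ord.
Qed.

Section Simulation.
Variables (R : realType) (s : nat) (A : algorithm R (token #|T|) s).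

(* The position in the stream is visible to the algorithm, so Alice also has to
   tell Bob the length of her part. *)
Definition mem_state : finType := ('I_(#|T| * #|T|.+1).+1 * s.-tuple bool)%type.

Definition scan (w : outcome A) i (m : s.-tuple bool) off (sigma : seq (token #|T|)) :=
  foldl (fun m jx => step w i jx.1 m jx.2) m (zip (iota off (size sigma)) sigma).

Definition simA w i (m : mem_state) x : mem_state :=
  (inord (size (streamA x)), scan w i m.2 0 (streamA x)).
Definition simB w i (m : mem_state) y : mem_state :=
  (m.1, scan w i m.2 m.1 (streamB y)).

Lemma run_simulation p w x y : run p (streamA x ++ streamB y) w =
  (proto_run (simA w) (simB w) p (ord0, start w) x y).2.
Proof.
rewrite /run /proto_run.
have -> : start w = ((ord0, start w) : mem_state).2 by [].
move: ((ord0, start w) : mem_state); elim: (iota 0 p) => //= i l IH m.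
rewrite -IH; congr foldl; rewrite /run_pass /simB /simA /= /scan.
(* Bob resumes at the offset sent by Alice, which the bound on her part keeps [inord] from
   truncating. *)
rewrite inordK ?ltnS ?size_streamA //.
by rewrite size_cat iotaD zip_cat ?size_iota // foldl_cat.
Qed.

(** The position takes [2 b + 2] bits, as [z (z + 1) + 1 <= 4 z^2] for [z = 2 ^ b]; and
    [ln 2 <= 1]. *)
Lemma ln_mem_state b : (#|T| <= 2 ^ b)%N -> ln #|mem_state|%:R <= (2 * b + 2 + s)%:R :> R.
Proof.
move=> Tb; have le2 : (#|mem_state| <= 2 ^ (2 * b + 2 + s))%N.
  rewrite card_prod card_ord card_tuple card_bool expnD leq_mul2r; apply/orP; right.
  apply: (@leq_trans (2 ^ b * (2 ^ b).+1).+1); first by rewrite ltnS leq_mul.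
  rewrite mul2n -addnn !expnD; have := expn_gt0 2 b; move: (2 ^ b)%N => z /=; nia.
have m0 : (0 : R) < #|mem_state|%:R.
  by rewrite ltr0n; apply/card_gt0P; exists (ord0, [tuple of nseq s true]).

rewrite -[leRHS]expRK ler_ln ?posrE ?expR_gt0 //.
rewrite -[(2 * b + 2 + s)%:R]mulr1 expRM_natl.
apply: (@le_trans _ _ (2 ^+ (2 * b + 2 + s))); first by rewrite -natrX ler_nat.
by apply: lerXn2r; rewrite ?nnegrE ?expR_ge0 //; have := expR_ge1Dx (1 : R); lra.
Qed.

End Simulation.
End Streams.

Section StreamBounds.
Variables (R : realType) (T I : finType) (Y : Type) (M : model) (isA : pred T).
Local Notation U := {ffun I -> bool}.
Variables (e : U -> Y -> rel T).
Hypothesis e_sym : forall x y, symmetric (e x y).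
Hypothesis e_irr : forall x y, irreflexive (e x y).
Variables (s : nat) (A : algorithm R (token #|T|) s) (y0 : Y).
Let x0 : U := [ffun=> false].
Let stream x y := streamA e_sym e_irr M isA y0 x ++ streamB e_sym e_irr M isA x0 y.

Lemma pr_answerE p x y (out : bool) : pr_answer A p (stream x y) out =
  \sum_(w | accept w (proto_run (simA e_sym e_irr M isA y0 (A:=A) w)
      (simB e_sym e_irr M isA x0 (A:=A) w) p (ord0, start w) x y).2 == out) weight w.
Proof. by apply: eq_bigl => w; rewrite run_simulation. Qed.

End StreamBounds.

(** The message is the memory after Alice's part of the single pass. The negation reflects that a
    bit 1 closes a cycle. *)
Lemma index_stream (R : realType) (T I : finType) (M : model) (isA : pred T)
    (e : {ffun I -> bool} -> I -> rel T)
    (e_sym : forall x y, symmetric (e x y)) (e_irr : forall x y, irreflexive (e x y))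
    (s b : nat) (A : algorithm R (token #|T|) s) i0 :
  (#|T| <= 2 ^ b)%N ->
  (forall x i, 2 / 3 <= pr_answer A 1
     (streamA e_sym e_irr M isA i0 x ++ streamB e_sym e_irr M isA [ffun=> false] i) (~~ x i)) ->
  #|I|%:R <= 72 * ((2 * b + 2 + s)%:R + 1) :> R.
Proof.
move=> Tb ok.
apply: (@le_trans _ _ (72 * (ln #|mem_state T s|%:R + 1))); last first.
  by have := ln_mem_state R s Tb; lra.
apply: (index_bound (wt := @weight _ _ _ A)
  (msg := fun w x => simA e_sym e_irr M isA i0 w 0 (ord0, start w) x)
  (out := fun w z i => ~~ accept w (simB e_sym e_irr M isA [ffun=> false] w 0 z i).2)).
- exact: weight_ge0.
- exact: weight_sum1.
- move=> x i; move: (ok x i); rewrite pr_answerE => /le_trans; apply.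
  rewrite le_eqVlt; apply/orP; left; apply/eqP; apply: eq_bigl => w.
  by rewrite /proto_run /=; case: (accept _ _); case: (x i).
Qed.

Lemma disjointness_stream (R : realType) (T I : finType) (M : model) (isA : pred T)
    (e : {ffun I -> bool} -> {ffun I -> bool} -> rel T)
    (e_sym : forall x y, symmetric (e x y)) (e_irr : forall x y, irreflexive (e x y))
    (s b p : nat) (A : algorithm R (token #|T|) s) :
  (#|T| <= 2 ^ b)%N ->
  (forall x y, 2 / 3 <= pr_answer A p
     (streamA e_sym e_irr M isA [ffun=> false] x ++ streamB e_sym e_irr M isA [ffun=> false] y)
     [forall i, ~~ (x i && y i)]) ->
  #|I|%:R <= 2304 * (2 * p%:R * (2 * b + 2 + s)%:R + 1) :> R.
Proof.
move=> Tb ok.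
apply: (@le_trans _ _ (2304 * (2 * p%:R * ln #|mem_state T s|%:R + 1))); last first.
  by rewrite ler_wpM2l // lerD2r ler_wpM2l ?ln_mem_state ?mulr_ge0 ?ler0n.
apply: (protocol_disjointness (W := outcome A) (S := mem_state T s) (p := p)
  (wt := @weight _ _ _ A)
  (fA := fun w => simA e_sym e_irr M isA [ffun=> false] w)
  (fB := fun w => simB e_sym e_irr M isA [ffun=> false] w)
  (st := fun w => (ord0, start w)) (acc := fun w m => accept w m.2)).
- exact: weight_ge0.
- exact: weight_sum1.
- move=> x y /forallP xy; move: (ok x y); rewrite pr_answerE xy.
  by under eq_bigl do rewrite eqb_id.
- move=> x y [i xy]; move: (ok x y); rewrite pr_answerE.
  have -> : [forall i, ~~ (x i && y i)] = false by apply/forallP => /(_ i); rewrite xy.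
  by under eq_bigl do rewrite eqbF_neg.
Qed.

(** * From communication bounds to asymptotic hardness *)

Section LittleO.
Local Open Scope classical_set_scope.

Lemma littleo_bound (R : realType) (s : nat -> nat) (f : nat -> R) (eps : R) :
  ((fun n => (s n)%:R : R^o) =o_\oo (fun n => f n : R^o)) -> 0 < eps ->
  exists N, forall n, (N <= n)%N -> (s n)%:R <= eps * `|f n|.
Proof.
move=> /eqoP so e0; have [N _ hN] := so _ e0.
exists N => n /hN /=; by rewrite normr_nat.
Qed.

End LittleO.

Lemma exp_dominates (C N : nat) : exists2 r, (N <= r)%N & (C * (2 * r + 9) < 2 ^ r)%N.
Proof.
(* [2 ^ (2 m)] exceeds [m^2], and [m >= 4 C + 5] makes this beat the linear term. *)
pose m := (4 * C + 5 + N)%N; exists (2 * m)%N; first by rewrite /m; lia.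
have mz : (m < 2 ^ m)%N by apply: ltn_expl.
have hm : (4 * C + 5 <= m)%N by rewrite /m leq_addr.
have -> : (2 ^ (2 * m) = 2 ^ m * 2 ^ m)%N by rewrite mul2n -addnn expnD.
apply: (leq_trans _ (leq_mul mz mz)).
by have := leq_mul hm (leqnn m); nia.
Qed.

Lemma ln_le_exponent (R : realType) (n b : nat) : (n <= 2 ^ b)%N -> ln n%:R <= b%:R :> R.
Proof.
move=> nb; have [->|n0] := posnP n; first by rewrite ln0 // ler0n.
rewrite -[leRHS]expRK ler_ln ?posrE ?expR_gt0 ?ltr0n //.
rewrite -[b%:R]mulr1 expRM_natl; apply: (@le_trans _ _ (2 ^+ b)).
  by rewrite -natrX ler_nat.
by apply: lerXn2r; rewrite ?nnegrE ?expR_ge0 //; have := expR_ge1Dx (1 : R); lra.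
Qed.

Lemma hard_of_disjointness (R : realType) Pi par M (C : forall n, graph n -> Prop) (p kappa : nat)
    (T : nat -> finType) (isA : forall r, pred (T r))
    (e : forall r, {ffun 'I_(2 ^ r) -> bool} -> {ffun 'I_(2 ^ r) -> bool} -> rel (T r))
    (e_sym : forall r x y, symmetric (e r x y)) (e_irr : forall r x y, irreflexive (e r x y)) :
  (0 < p)%N -> (forall r, 2 ^ r <= #|T r| <= 2 ^ (r + 3))%N ->
  (forall r x y y' t u, isA r t -> (M = VA -> isA r u) -> e r x y t u = e r x y' t u) ->
  (forall r x x' y t u, ~~ isA r t -> e r x y t u = e r x' y t u) ->
  (forall r x y, let G := instance (e_sym r) (e_irr r) x y in
     [/\ C _ G, admissible par G kappa 0,
       (forall i, ~~ (x i && y i)) -> yes_instance Pi G 0 &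
       forall i, x i -> y i -> ~ yes_instance Pi G 0]) ->
  hard R Pi par M C (fun n _ => n%:R / p%:R) p.
Proof.
move=> p0 cardT locA locB red s A so sol.
have pR : (0 : R) < p%:R by rewrite ltr0n.
(* With [b = r + 3], the position and additive terms stay below [2304 * 2 p (2 r + 9) < 2 ^ r / 2],
   and the memory term [2304 * 2 p s] is at most [2 ^ r / 2] because there are at most [8 * 2 ^ r]
   vertices. *)
have eps0 : (0 : R) < 1 / (32 * 2304) by rewrite divr_gt0 ?mulr_gt0 ?ltr0n.
have [N hN] := littleo_bound (so kappa) eps0.
have [r rN big] := exp_dominates (4 * 2304 * p) N.
have /andP[T1 T2] := cardT r.
have NT : (N <= #|T r|)%N by rewrite (leq_trans rN) // (leq_trans _ T1) // ltnW // ltn_expl.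
have := hN _ NT; rewrite ger0_norm ?divr_ge0 ?ler0n // => sle.
have ok x y : 2 / 3 <= pr_answer (A #|T r| kappa 0%N) p
    (streamA (e_sym r) (e_irr r) M (isA r) [ffun=> false] x ++
     streamB (e_sym r) (e_irr r) M (isA r) [ffun=> false] y) [forall i, ~~ (x i && y i)].
  have [CG adm yes no] := red r x y.
  have st := stream_instance (e_sym r) (e_irr r) (@locA r) (@locB r) [ffun=> false] [ffun=> false] x y.
  have [ok1 ok2] := sol _ _ _ _ _ CG adm st.
  have [/forallP d|] := boolP [forall i, ~~ (x i && y i)]; first by apply: ok1; apply: yes.
  rewrite negb_forall => /existsP[i]; rewrite negbK => /andP[xi yi].
  by apply: ok2; apply: no xi yi.
have := disjointness_stream T2 ok; rewrite card_ord.
have TR : #|T r|%:R <= 8 * (2 ^ r)%:R :> R by rewrite -natrM ler_nat (leq_trans T2) // expnD mulnC.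
move: big; rewrite -(ltr_nat R) !natrM !natrD => big.
have ps : p%:R * (s #|T r| kappa)%:R <= 1 / (32 * 2304) * (8 * (2 ^ r)%:R) :> R.
  rewrite mulrC -ler_pdivlMr // (le_trans sle) // -[leRHS]mulrA ler_wpM2l ?(ltW eps0) //.
  by rewrite ler_pM2r ?invr_gt0.
move: big ps.
have p1 : (1 : R) <= p%:R by rewrite ler1n.
have r0 : (0 : R) <= r%:R by rewrite ler0n.
move: (2 ^ r)%:R p%:R r%:R (s _ _)%:R p1 r0 => z q t v p1 r0 h1 h2.
by have := mulr_ge0 (le_trans ler01 p1) r0; nra.
Qed.

Lemma hard_of_index (R : realType) Pi par (C : forall n, graph n -> Prop) (kappa : nat) M
    (T I : nat -> finType) (isA : forall r, pred (T r))
    (e : forall r, {ffun I r -> bool} -> I r -> rel (T r))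
    (e_sym : forall r x y, symmetric (e r x y)) (e_irr : forall r x y, irreflexive (e r x y)) :
  (forall r, #|I r| = 2 ^ r * r)%N -> (forall r, 2 ^ r <= #|T r| <= 2 ^ (r + 3))%N ->
  (forall r x y y' t u, isA r t -> (M = VA -> isA r u) -> e r x y t u = e r x y' t u) ->
  (forall r x x' y t u, ~~ isA r t -> e r x y t u = e r x' y t u) ->
  (forall r x i, let G := instance (e_sym r) (e_irr r) x i in
     [/\ C _ G, admissible par G kappa 0 & yes_instance Pi G 0 <-> ~~ x i]) ->
  hard R Pi par M C (fun n _ => n%:R * ln n%:R) 1.
Proof.
move=> cardI cardT locA locB red s A so sol.
(* Here [72 (2 r + 9) < 2 ^ r r / 2], and [72 s <= 2 ^ r r / 2] because [r + 3 <= 4 r]. Asking for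
   [r > N] below ensures [r > 0]. *)
have eps0 : (0 : R) < 1 / (64 * 72) by rewrite divr_gt0 ?mulr_gt0 ?ltr0n.
have [N hN] := littleo_bound (so kappa) eps0.
have [r rN big] := exp_dominates 144 N.+1.
have /andP[T1 T2] := cardT r.
have NT : (N <= #|T r|)%N by rewrite (leq_trans (ltnW rN)) // (leq_trans _ T1) // ltnW // ltn_expl.
have r0 : (0 < r)%N by apply: leq_trans rN.
have T0 : (0 < #|T r|)%N by apply: leq_trans T1; rewrite expn_gt0.
have /card_gt0P[i0 _] : (0 < #|I r|)%N by rewrite cardI muln_gt0 expn_gt0 r0.
have lnT0 : 0 <= ln #|T r|%:R :> R by rewrite ln_ge0 // ler1n.
have := hN _ NT; rewrite ger0_norm ?mulr_ge0 ?ler0n // => sle.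
have ok x i : 2 / 3 <= pr_answer (A #|T r| kappa 0%N) 1
    (streamA (e_sym r) (e_irr r) M (isA r) i0 x ++
     streamB (e_sym r) (e_irr r) M (isA r) [ffun=> false] i) (~~ x i).
  have [CG adm yes] := red r x i.
  have st := stream_instance (e_sym r) (e_irr r) (@locA r) (@locB r) [ffun=> false] i0 x i.
  have [ok1 ok2] := sol _ _ _ _ _ CG adm st.
  by case E: (x i) => /=; [apply: ok2 => /yes; rewrite E | apply: ok1; apply/yes; rewrite E].
have := index_stream T2 ok; rewrite cardI.
have TR : #|T r|%:R <= 8 * (2 ^ r)%:R :> R by rewrite -natrM ler_nat (leq_trans T2) // expnD mulnC.
have lnT := ln_le_exponent R T2.
move: big; rewrite -(ltr_nat R) !natrM !natrD => big.
have st : (s #|T r| kappa)%:R <= 1 / (64 * 72) * (8 * (2 ^ r)%:R * (r%:R + 3)) :> R.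
  rewrite (le_trans sle) // ler_wpM2l ?(ltW eps0) // ler_pM ?ler0n //.
  by rewrite (le_trans lnT) // natrD.
move: big st.
have r1 : (1 : R) <= r%:R by rewrite ler1n.
have z0 : (0 : R) <= (2 ^ r)%:R by rewrite ler0n.
move: (2 ^ r)%:R r%:R (s _ _)%:R r1 z0 => z t v r1 z0 h1 h2.
by nra.
Qed.

(** * Reductions *)

Lemma delete0 n (G : graph n) : delete G set0 =2 G.
Proof. by move=> u v; rewrite /delete /= !inE. Qed.

Lemma eq_graph_cycle n (e e' : rel 'I_n) c : e =2 e' -> graph_cycle e c = graph_cycle e' c.
Proof. by move=> ee; rewrite /graph_cycle /ucycleb (eq_cycle ee). Qed.

Lemma no_of_cycle Pi n (G : graph n) c :
  graph_cycle G c -> forbidden_length Pi (size c) -> ~ yes_instance Pi G 0.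
Proof.
move=> Gc Lc [X [X0 noc]]; apply: noc; exists c; split=> //.
move: X0; rewrite leqn0 cards_eq0 => /eqP ->.
by rewrite (eq_graph_cycle c (delete0 G)).
Qed.

(* A rank orients every edge of a forest towards the root; the vertex of least rank
   on a cycle would have two neighbours of larger rank. *)
Lemma yes_of_rank Pi n (G : graph n) (rk : 'I_n -> nat) :
  (forall v u u', G v u -> G v u' -> rk v <= rk u -> rk v <= rk u' -> u = u')%N ->
  yes_instance Pi G 0.
Proof.
move=> forest; exists set0; rewrite cards0; split=> // -[c []].
rewrite (eq_graph_cycle c (delete0 G)) /graph_cycle => /andP[c2 uc] _.
have [v0 v0c] : exists v, v \in c by case: c c2 {uc} => // v c _; exists v; rewrite mem_head.
case: (arg_minnP rk v0c) => v vc vmin.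
(* Once the cycle starts at [v], the neighbours of [v] are its second and last entries, distinct as
   its length is at least 3. *)
have [i c' cE] := rot_to vc.
have uc' : ucycleb G (v :: c') by rewrite -cE /ucycleb rot_cycle rot_uniq.
have sz : (2 < size (v :: c'))%N by rewrite -cE size_rot.
have mem u : u \in c' -> (rk v <= rk u)%N.
  move=> uc''; apply: vmin; have : u \in rot i c by rewrite cE inE uc'' orbT.
  by rewrite mem_rot.
case: c' => [|a [|b c']] // in cE uc' sz mem.
move: uc'; rewrite /ucycleb /= rcons_path => /andP[/and3P[va _ /andP[_ lv]]] /and3P[_].
rewrite inE negb_or => /andP[ab ac'] _.
have := forest v a (last b c') va; rewrite adj_sym lv => /(_ isT).
rewrite !mem ?mem_head //; last by rewrite inE mem_last orbT.
move=> /(_ isT isT) al; move: (mem_last b c'); rewrite -al inE => /orP[/eqP ba|]; last by rewrite (negbTE ac').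
by rewrite ba eqxx in ab.
Qed.

Section Instances.
Variables (T : finType) (X Y : Type) (e : X -> Y -> rel T).
Hypothesis e_sym : forall x y, symmetric (e x y).
Hypothesis e_irr : forall x y, irreflexive (e x y).
Variables (x : X) (y : Y).
Local Notation G := (instance e_sym e_irr x y).

Lemma instance_forest Pi (rk : T -> nat) :
  (forall t u u', e x y t u -> e x y t u' -> rk t <= rk u -> rk t <= rk u' -> u = u')%N ->
  yes_instance Pi G 0.
Proof.
move=> h; apply: (@yes_of_rank _ _ _ (fun v => rk (enum_val v))) => v u u' a b c d.
exact: enum_val_inj (h _ _ _ a b c d).
Qed.

Lemma instance_cycle Pi (c : seq T) : (2 < size c)%N -> ucycleb (e x y) c ->
  forbidden_length Pi (size c) -> ~ yes_instance Pi G 0.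
Proof.
move=> c2 /andP[cc uc] fc; apply: (@no_of_cycle _ _ _ (map enum_rank c)); last by rewrite size_map.
rewrite /graph_cycle size_map c2 /ucycleb map_inj_uniq ?uc ?andbT; last exact: enum_rank_inj.
rewrite cycle_map; apply: sub_cycle cc => t u tu /=.
by rewrite !enum_rankK.
Qed.

(** Every edge joins a vertex to one of its two heads [g1], [g2], so there are at most twice as many
    edges as vertices. *)
Lemma instance_avg_degree (R : realType) (g1 g2 : T -> T) :
  (forall t u, e x y t u -> [|| u == g1 t, u == g2 t, t == g1 u | t == g2 u]) ->
  avg_degree G R <= 4.
Proof.
move=> h; rewrite /avg_degree.
have [T0|T0] := posnP #|T|.
  by rewrite [X in _ / X](_ : _ = 0) ?invr0 ?mulr0 // T0.
rewrite ler_pdivrMr ?ltr0n // -natrM ler_nat.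
have degE v : degree G v = (\sum_(u : T) e x y (enum_val v) u)%N.
  rewrite (reindex _ (onW_bij _ (enum_val_bij T))) /= /degree cardsE -sum1_card big_mkcond /=.
  by apply: eq_bigr => u _; rewrite unfold_in /=; case: e.
rewrite (eq_bigr _ (fun v _ => degE v)).
have -> : (\sum_(v < #|T|) \sum_u e x y (enum_val v) u = \sum_t \sum_u e x y t u)%N.
  by rewrite [RHS](reindex _ (onW_bij _ (enum_val_bij T))).
have sum1 (g : T -> T) : (\sum_t \sum_u (u == g t) = #|T|)%N.
  rewrite -[RHS]sum1_card; apply: eq_bigr => t _.
  by rewrite (bigD1 (g t)) //= eqxx big1 // => u /negbTE ->.
apply: (@leq_trans (\sum_t \sum_u ((u == g1 t) + (u == g2 t) + ((t == g1 u) + (t == g2 u))))%N).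
  apply: leq_sum => t _; apply: leq_sum => u _; have := h t u.
  by case: e => // /(_ isT); do 4 case: eqP => //= _.
under eq_bigr do rewrite !big_split /=.
rewrite !big_split /= !sum1.
by rewrite [X in (_ + (X + _))%N]exchange_big [X in (_ + (_ + X))%N]exchange_big /= !sum1 !mulSn addn0 !addnA.
Qed.

Lemma instance_degree_le (B : {set T}) v t : enum_val v = t ->
  (forall u, e x y t u -> u \in B) -> (degree G v <= #|B|)%N.
Proof.
move=> vt h; rewrite /degree -(card_imset _ (@enum_rank_inj T)).
apply: subset_leq_card; apply/subsetP => u; rewrite !inE /= vt => /h uB.
by apply/imsetP; exists (enum_val u); rewrite ?enum_valK.
Qed.

Lemma instance_cover (B : {set T}) : (forall t u, e x y t u -> (t \in B) || (u \in B)) ->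
  (vertex_cover_number G <= #|B|)%N.
Proof.
move=> h; rewrite -(card_imset _ (@enum_rank_inj T)) /vertex_cover_number.
set C := enum_rank @: B.
have cC : vertex_cover G C.
  apply/'forall_forallP => u v; apply/implyP => /h.
  by rewrite -!(mem_imset _ _ (@enum_rank_inj T)) !enum_valK.
rewrite -big_filter; have : C \in [seq D <- index_enum {set 'I_#|T|} | vertex_cover G D].
  by rewrite mem_filter cC mem_index_enum.
elim: [seq _ <- _ | _] => //= D l IH; rewrite big_cons inE => /orP[/eqP <-|/IH lC].
  exact: geq_minl.
exact: leq_trans (geq_minr _ _) lC.
Qed.

End Instances.

(** The odd cycles serve Feedback Vertex Set as well, which forbids every length. *)
Definition is_even Pi := if Pi is EvenCycleTransversal then true else false.

Definition symc (T : Type) (b : rel T) : rel T := [rel t u | b t u || b u t].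

Lemma symc_sym (T : Type) (b : rel T) : symmetric (symc b).
Proof. by move=> t u; rewrite /symc /= orbC. Qed.

Lemma symc_irr (T : Type) (b : rel T) : irreflexive b -> irreflexive (symc b).
Proof. by move=> h t; rewrite /symc /= h. Qed.

(** * Two hubs: vertex arrival with bounded vertex cover *)

Section Hub.
Variables (ev : bool) (r : nat).
Local Notation U := {ffun 'I_(2 ^ r) -> bool}.
Definition hub_vertex : finType := ('I_(2 ^ r) + 'I_3)%type.

(* The hubs are [u = inr 0] and [w = inr 1], joined by an edge or, to make the
   cycles even, by a path through [inr 2]. *)
Definition hub_arc (x y : U) : rel hub_vertex := fun t u =>
  match t, u with
  | inl i, inr k => match val k with 0 => x i | 1 => y i | _ => false end
  | inr k, inr l => match val k, val l with 2, 0 | 2, 1 => ev | 0, 1 => ~~ ev | _, _ => false end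
  | _, _ => false
  end.

Definition hub (x y : U) := symc (hub_arc x y).

Lemma hub_sym x y : symmetric (hub x y). Proof. exact: symc_sym. Qed.
Lemma hub_irr x y : irreflexive (hub x y).
Proof. by apply: symc_irr => -[i|[[|[|[|]]] k]]. Qed.

(** Bob holds only the hub [w]: arriving last, it reveals every edge that depends on [y]. *)
Definition hub_alice : pred hub_vertex := fun t => if t is inr k then val k != 1%N else true.

Lemma hub_alice_local x y y' t u : hub_alice t -> hub_alice u -> hub x y t u = hub x y' t u.
Proof. by case: t => [i|[[|[|[|]]] k]] //; case: u => [j|[[|[|[|]]] l]]. Qed.

Lemma hub_bob_local x x' y t u : ~~ hub_alice t -> hub x y t u = hub x' y t u.
Proof. by case: t => [i|[[|[|[|]]] k]] //; case: u => [j|[[|[|[|]]] l]]. Qed.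

(** Rooted at [w]: elements lie below both hubs, and [u] reaches [w] directly or through [inr 2]. *)
Definition hub_rank (t : hub_vertex) : nat :=
  if t is inr k then nth 0%N [:: 1; 3; 2]%N k else 0%N.

Lemma hub_forest (x y : U) t u u' : (forall i, ~~ (x i && y i)) ->
  (hub x y t u -> hub x y t u' -> hub_rank t <= hub_rank u -> hub_rank t <= hub_rank u' -> u = u')%N.
Proof.
move=> disj; case: t => [i|[[|[|[|]]] k]] //; case: u => [j|[[|[|[|]]] l]] //;
  case: u' => [j'|[[|[|[|]]] l']] //; rewrite /hub /symc /= ?orbF => h h' _ _ //;
  try by congr inr; apply: val_inj.
- by move: (disj i); rewrite h h'.
- by move: (disj i); rewrite h h'.
- by move: h; rewrite h'.
- by move: h'; rewrite h.
Qed.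

(** Every edge meets a hub, which serves both the average degree and the vertex cover. *)
Lemma hub_heads (x y : U) t u : hub x y t u ->
  [|| u == inr (inord 0), u == inr (inord 1), t == inr (inord 0) | t == inr (inord 1)].
Proof.
have i0 k : (inr (@Ordinal 3 0 k) : hub_vertex) == inr (inord 0).
  by apply/eqP; congr inr; apply: val_inj; rewrite /= inordK.
have i1 k : (inr (@Ordinal 3 1 k) : hub_vertex) == inr (inord 1).
  by apply/eqP; congr inr; apply: val_inj; rewrite /= inordK.
case: t => [i|[[|[|[|]]] k]] //; case: u => [j|[[|[|[|]]] l]] //; by rewrite ?i0 ?i1 ?orbT.
Qed.

Definition hub_cycle i : seq hub_vertex :=
  [:: inl i, inr (inord 0) & if ev then [:: inr (inord 2); inr (inord 1)] else [:: inr (inord 1)]].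

Lemma hub_cycle_ucycle (x y : U) i : x i -> y i -> ucycleb (hub x y) (hub_cycle i).
Proof.
move=> xi yi; rewrite /ucycleb /hub_cycle; have ii k l := inj_eq (@inr_inj 'I_(2 ^ r) 'I_3) k l.
case E: ev; rewrite /= !inE ?ii -?val_eqE /= ?inordK // /hub /symc /= ?inordK // xi yi E //.
Qed.

End Hub.

(** * Disjoint short cycles: bounded maximum degree *)

Section Gadgets.
Variables (ev : bool) (r : nat).
Local Notation U := {ffun 'I_(2 ^ r) -> bool}.
Definition gadget_vertex : finType := ('I_(2 ^ r) * 'I_5)%type.

(* Gadget [i] is a 4-cycle 0-1-2-3, or the 5-cycle 0-4-1-2-3, in which Alice owns
   the edge 3-0 and Bob the edge 1-2. *)
Definition gadget_arc (xi yi : bool) (k l : nat) : bool :=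
  match k, l with
  | 0, 1 => ev | 0, 4 | 4, 1 => ~~ ev | 1, 2 => yi | 2, 3 => true | 3, 0 => xi | _, _ => false
  end.

Definition gadgets (x y : U) : rel gadget_vertex := fun t u =>
  (t.1 == u.1) && symc (gadget_arc (x t.1) (y t.1)) t.2 u.2.

Lemma gadgets_sym x y : symmetric (gadgets x y).
Proof. by move=> t u; rewrite /gadgets eq_sym; case: eqP => //= ->; rewrite symc_sym. Qed.

Lemma gadgets_irr x y : irreflexive (gadgets x y).
Proof. by move=> [i k]; rewrite /gadgets /= /symc /= /gadget_arc; case: k => [[|[|[|[|[|]]]]] k] /=; rewrite andbF. Qed.

(** Both ends of an input-dependent edge belong to its owner, since the AL model reveals it from
    both ends. *)
Definition gadget_alice : pred gadget_vertex := fun t => val t.2 \in [:: 0; 3; 4]%N.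

Lemma gadget_alice_local x y y' t u : gadget_alice t -> gadgets x y t u = gadgets x y' t u.
Proof.
by case: t u => [i k] [j l]; case: k => [[|[|[|[|[|]]]]] k] //; case: l => [[|[|[|[|[|]]]]] l].
Qed.

Lemma gadget_bob_local x x' y t u : ~~ gadget_alice t -> gadgets x y t u = gadgets x' y t u.
Proof.
by case: t u => [i k] [j l]; case: k => [[|[|[|[|[|]]]]] k] //; case: l => [[|[|[|[|[|]]]]] l].
Qed.

(** The position along the path 0-4-1-2-3 if the edge 3-0 is absent, along 1-4-0-3-2 otherwise,
    skipping 4 in the even case. *)
Definition gadget_rank (y : U) (t : gadget_vertex) : nat :=
  nth 0%N (if y t.1 then [:: 0; 2; 3; 4; 1]%N else [:: 2; 0; 4; 3; 1]%N) t.2.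

Lemma gadgets_forest (x y : U) t u u' : (forall i, ~~ (x i && y i)) ->
  (gadgets x y t u -> gadgets x y t u' -> gadget_rank y t <= gadget_rank y u ->
   gadget_rank y t <= gadget_rank y u' -> u = u')%N.
Proof.
case: t u u' => [i k] [j l] [j' l'] disj; rewrite /gadgets /gadget_rank /symc /=.
case: eqP => //= <-; case: eqP => //= <-; move: (disj i).
case: (x i) (y i) => -[] //= _; case: k => [[|[|[|[|[|]]]]] k] //; case: l => [[|[|[|[|[|]]]]] l] //=;
  case: l' => [[|[|[|[|[|]]]]] l'] //= evk evl _ _; solve [by congr pair; apply: val_inj | by case: ev evk evl].
Qed.

Definition gadget_cycle i : seq gadget_vertex :=
  [seq (i, inord k) | k <- if ev then [:: 0; 1; 2; 3]%N else [:: 0; 4; 1; 2; 3]%N].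

Lemma gadget_cycle_ucycle (x y : U) i : x i -> y i -> ucycleb (gadgets x y) (gadget_cycle i).
Proof.
move=> xi yi; rewrite /ucycleb /gadget_cycle; case E: ev;
by rewrite /= !inE !xpair_eqE -!val_eqE /= !inordK // /gadgets /= eqxx /symc /= !inordK // /gadget_arc /= xi yi E !eqxx.
Qed.

End Gadgets.

(** * Encoding words by edges: the INDEX reduction *)

Section Lookup.
Variables (ev : bool) (r : nat).
Local Notation J := {ffun 'I_r -> bool}.
Definition lookup_index : finType := (J * 'I_r)%type.
Local Notation U := {ffun lookup_index -> bool}.
Definition lookup_vertex : finType := (J * 'I_4 + bool)%type.

Definition word (x : U) (i : J) : J := [ffun l => x (i, l)].

(* The bit queried at position [(i, l)] is read off by the path
   [b_i - a_i - c_(word x i) - d_(word x i)] with [a, b, c, d = 0, 1, 2, 3]: Bob joins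
   [b_i] to a centre [z = inr true], through [inr false] if cycles must be even, and
   joins [z] to every [d_j] with [j l = 1]. *)
Definition lookup_arc (x : U) (q : lookup_index) : rel lookup_vertex := fun t u =>
  match t, u with
  | inl (i, k), inl (j, l) =>
      match val k, val l with 0, 1 | 3, 2 => i == j | 0, 2 => j == word x i | _, _ => false end
  | inl (i, k), inr c =>
      match val k with 1 => (i == q.1) && (c == ~~ ev) | 3 => c && i q.2 | _ => false end
  | inr c, inr c' => [&& ev, ~~ c & c']
  | _, _ => false
  end.

Definition lookup (x : U) (q : lookup_index) := symc (lookup_arc x q).

Lemma lookup_sym x q : symmetric (lookup x q). Proof. exact: symc_sym. Qed.
Lemma lookup_irr x q : irreflexive (lookup x q).
Proof. by apply: symc_irr => -[[i [[|[|[|[|]]]] k]]|[]] //=; rewrite andbF. Qed.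

Definition lookup_alice : pred lookup_vertex := fun t =>
  if t is inl (i, k) then val k \in [:: 0; 2]%N else false.

Lemma lookup_alice_local x q q' t u : lookup_alice t -> lookup x q t u = lookup x q' t u.
Proof.
by case: t => [[i [[|[|[|[|]]]] k]]|b] //; case: u => [[j [[|[|[|[|]]]] l]]|c].
Qed.

Lemma lookup_bob_local x x' q t u : ~~ lookup_alice t -> lookup x q t u = lookup x' q t u.
Proof.
by case: t => [[i [[|[|[|[|]]]] k]]|b] //; case: u => [[j [[|[|[|[|]]]] l]]|c].
Qed.

(** Rooted at [z]. The queried path hangs by its vertex [b], its end [d] not being joined to [z];
    any other [c_j] hangs by [d_j], and the other [a], [b] lie below. *)
Definition lookup_rank (x : U) (q : lookup_index) (t : lookup_vertex) : nat :=
  match t with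
  | inl (i, k) => match val k with
      | 0 => if i == q.1 then 4 else 1
      | 1 => if i == q.1 then 5 else 0
      | 2 => 3
      | _ => if i == word x q.1 then 2 else 4
      end
  | inr false => 6
  | inr true => 7
  end%N.

Lemma lookup_forest (x : U) (q : lookup_index) t u u' : ~~ x q ->
  (lookup x q t u -> lookup x q t u' -> lookup_rank x q t <= lookup_rank x q u ->
   lookup_rank x q t <= lookup_rank x q u' -> u = u')%N.
Proof.
move=> xq.
have wq : word x q.1 q.2 = false by rewrite ffunE -surjective_pairing (negbTE xq).
case: t => [[i [[|[|[|[|]]]] k]]|[]] //; case: u => [[j [[|[|[|[|]]]] l]]|[]] //;
  case: u' => [[j' [[|[|[|[|]]]] l']]|[]] //; rewrite /lookup /symc /= ?orbF ?andbF //=.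
all: move=> h h'.
all: repeat match goal with H : is_true (_ == _) |- _ => move/eqP: H => H; subst end.
all: rewrite ?eqxx //.
all: try by move=> _ _; congr (inl (_, _)); apply: val_inj.
all: try by case: ifP; case: ifP.
all: try by case: ifP.
- by case/andP: h' => /eqP ->; rewrite eqxx.
- by case/andP: h' => /eqP ->; rewrite eqxx.
- by case/andP: h => /eqP ->; rewrite eqxx.
- by move: h h'; case: ev; rewrite !andbF.
- by case/andP: h => /eqP ->; rewrite eqxx.
- by move: h h'; case: ev; rewrite !andbF.
- case: eqP => // ->; case: eqP => // -> _ _; congr (inl (_, _)); exact: val_inj.
- by case: eqP => // ->; rewrite eqxx.
- by case: (j' =P _) => // ->; rewrite eqxx.
- by case: eqP => // jw; move: h'; rewrite jw wq.
- by case: eqP => // jw; move: h; rewrite jw wq.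
Qed.

(** Heads that account for all edges: [a_i] takes [b_i] and its word vertex, [d_j] takes [c_j] and
    [z]. Values at other vertices may be fillers. *)
Definition lookup_head1 (t : lookup_vertex) : lookup_vertex :=
  match t with
  | inl (i, k) => match val k with
      | 0 => inl (i, inord 1)
      | 1 => inr (~~ ev)
      | _ => inl (i, inord 2)
      end
  | inr _ => inr true
  end.

Definition lookup_head2 (x : U) (t : lookup_vertex) : lookup_vertex :=
  match t with
  | inl (i, k) => if val k is 0 then inl (word x i, inord 2) else inr true
  | inr _ => inr true
  end.

Lemma lookup_heads (x : U) q t u : lookup x q t u ->
  [|| u == lookup_head1 t, u == lookup_head2 x t, t == lookup_head1 u | t == lookup_head2 x u].
Proof.
have in2 i k : (inl (i, @Ordinal 4 2 k) : lookup_vertex) == inl (i, inord 2).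
  by apply/eqP; congr (inl (_, _)); apply: val_inj; rewrite /= inordK.
have in1 i k : (inl (i, @Ordinal 4 1 k) : lookup_vertex) == inl (i, inord 1).
  by apply/eqP; congr (inl (_, _)); apply: val_inj; rewrite /= inordK.
rewrite /lookup /symc.
case: t => [[i [[|[|[|[|]]]] k]]|[]] //; case: u => [[j [[|[|[|[|]]]] l]]|[]] //=; rewrite ?orbF ?andbF //=.
all: repeat match goal with |- is_true (_ == _) -> _ => move/eqP => H; subst end.
all: rewrite ?in1 ?in2 ?eqxx ?orbT //.
all: by case/andP => _ /eqP <-.
Qed.

Definition lookup_cycle (x : U) (q : lookup_index) : seq lookup_vertex :=
  [:: inl (q.1, inord 1), inl (q.1, inord 0), inl (word x q.1, inord 2), inl (word x q.1, inord 3),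
      inr true & if ev then [:: inr false] else [::]].

Lemma lookup_cycle_ucycle (x : U) (q : lookup_index) : x q -> ucycleb (lookup x q) (lookup_cycle x q).
Proof.
move=> xq; have wq : word x q.1 q.2 by rewrite ffunE -surjective_pairing.
rewrite /ucycleb /lookup_cycle; case E: ev.
all: rewrite /= !inE /eq_op /= !xpair_eqE -!val_eqE /= !inordK // /lookup /symc /= !inordK // E !eqxx wq.
all: by rewrite /= !andbF.
Qed.

End Lookup.

Theorem theorem5p1 (R : realType) (Pi : problem) :
  [/\ exists c : R,
        hard R Pi SolutionSize AL (fun n (G : graph n) => avg_degree G R <= c)
             (fun n _ => n%:R * ln n%:R) 1,
      exists c : nat, forall p : nat, (0 < p)%N ->
        hard R Pi SolutionSize AL (fun n (G : graph n) => (max_degree G <= c)%N)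
             (fun n _ => n%:R / p%:R) p
    & exists c : R, forall p : nat, (0 < p)%N ->
        hard R Pi VertexCoverSize VA (fun n (G : graph n) => avg_degree G R <= c)
             (fun n _ => n%:R / p%:R) p].
Proof.
pose ev := is_even Pi.
(* 4 comes from two heads per vertex, 5 is the size of a gadget. *)
split; [exists 4 | exists 5%N => p p0 | exists 4 => p p0].
- apply: (@hard_of_index R Pi _ _ 0%N AL lookup_vertex lookup_index lookup_alice
    (lookup ev) (lookup_sym ev) (lookup_irr ev)).
  + by move=> r; rewrite card_prod card_ffun card_bool card_ord.
  + move=> r; rewrite card_sum card_prod card_ffun card_bool !card_ord.
    by rewrite expnD; have := expn_gt0 2 r; move: (2 ^ r)%N => z; lia.
  + by move=> r x y y' t u At _; apply: lookup_alice_local.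
  + by move=> r x x' y t u; apply: lookup_bob_local.
  move=> r x q /=; split=> //; first by apply: instance_avg_degree; apply: lookup_heads.
  have [xq|xq] := boolP (x q); split=> //.
  + suff no : ~ yes_instance Pi (instance (@lookup_sym ev r) (@lookup_irr ev r) x q) 0 by [].
    apply: (@instance_cycle _ _ _ _ _ _ _ _ _ (lookup_cycle ev x q)) => //.
    * exact: lookup_cycle_ucycle.
    * by rewrite /lookup_cycle /ev; case: (Pi).
  + move=> _; apply: (@instance_forest _ _ _ _ _ _ _ _ _ (lookup_rank x q)) => t u u'.
    exact: lookup_forest.
- apply: (@hard_of_disjointness R Pi _ _ _ p 0%N gadget_vertex gadget_alice (gadgets ev)
    (gadgets_sym ev) (gadgets_irr ev)) => //.
  + move=> r; rewrite card_prod !card_ord.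
    by rewrite expnD; have := expn_gt0 2 r; move: (2 ^ r)%N => z; lia.
  + by move=> r x y y' t u At _; apply: gadget_alice_local.
  + by move=> r x x' y t u; apply: gadget_bob_local.
  move=> r x y /=; split=> //.
  + apply/bigmax_leqP => v _; case E: (enum_val v) => [i k].
    apply: (@leq_trans #|[set ((i, l) : gadget_vertex r) | l : 'I_5]|).
      by apply: instance_degree_le E _ => -[j l] /andP[/eqP /= <- _]; apply: imset_f.
    by rewrite (leq_trans (leq_imset_card _ _)) // card_ord.
  + move=> disj; apply: (@instance_forest _ _ _ _ _ _ _ _ _ (gadget_rank y)) => t u u'.
    exact: gadgets_forest disj.
  + move=> i xi yi; apply: (@instance_cycle _ _ _ _ _ _ _ _ _ (gadget_cycle ev i)).
    * by rewrite /gadget_cycle; case: ev.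
    * exact: gadget_cycle_ucycle.
    * by rewrite /gadget_cycle /ev; case: (Pi).
(* The parameter value 2 is the size of the cover by the two hubs. *)
apply: (@hard_of_disjointness R Pi _ _ _ p 2%N hub_vertex hub_alice (hub ev)
    (hub_sym ev) (hub_irr ev)) => //.
+ move=> r; rewrite card_sum !card_ord.
  by rewrite expnD; have := expn_gt0 2 r; move: (2 ^ r)%N => z; lia.
+ by move=> r x y y' t u At Au; apply: hub_alice_local => //; apply: Au.
+ by move=> r x x' y t u; apply: hub_bob_local.
move=> r x y /=; split=> //.
+ by apply: instance_avg_degree; apply: hub_heads.
+ split=> //; apply: leq_trans (instance_cover (B := [set inr (inord 0); inr (inord 1)]) _ _ _) _.
    move=> t u /hub_heads; rewrite !inE => /or4P[] ->; by rewrite ?orbT.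
  by rewrite cards2; case: (_ != _).
+ move=> disj; apply: (@instance_forest _ _ _ _ _ _ _ _ _ (@hub_rank r)) => t u u'.
  exact: hub_forest disj.
+ move=> i xi yi; apply: (@instance_cycle _ _ _ _ _ _ _ _ _ (hub_cycle ev i)).
  * by rewrite /hub_cycle; case: ev.
  * exact: hub_cycle_ucycle.
  * by rewrite /hub_cycle /ev; case: (Pi).
Qed.
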